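(* Let $R$ be a right coherent ring and let $M$ be an $R$-bimodule which is finitely presented both as a left and as a right $R$-module. 1. If $R$ has finite left pure global dimension, then $\mathsf{K}(\mathsf{Add}({}_RM))$ is compactly generated. 2. If ${}_RM$ is projective and every flat left $R$-module has finite projective dimension, then $\mathsf{K}(\mathsf{Add}({}_RM))$ is compactly generated. In particular (taking $M=R$), if every flat left $R$-module has finite projective dimension, then $\mathsf{K}(\mathsf{Proj}\,R)$ is compactly generated.
   Context: Modules are left $R$-modules unless otherwise specified; ${}_RM$ is $M$ viewed as a left module. $\mathsf{Proj}\,R$ is the class of projective left modules. For a class (or single module) $\mathbb{A}$, $\mathsf{Add}\,\mathbb{A}$ is the class of modules isomorphic to a direct summand of a coproduct $\coprod_{i\in I}A_i$ with $A_i\in\mathbb{A}$, $I$ an arbitrary set. For a class $\mathbb{X}=\mathsf{Add}\,\mathbb{X}$, $\mathsf{K}(\mathbb{X})$ is the triangulated category with objects the ($\mathbb{Z}$-indexed) chain complexes of modules from $\mathbb{X}$ and morphisms the chain maps modulo homotopy. A triangulated category $\mathsf{T}$ with set-indexed coproducts is compactly generated if there is a set $\mathcal{G}$ of compact objects (objects $C$ for which $\coprod_i\operatorname{Hom}_{\mathsf T}(C,X_i)\to\operatorname{Hom}_{\mathsf T}(C,\coprod_iX_i)$ is always an isomorphism) such that, for all $X\in\mathsf{T}$, $\operatorname{Hom}_{\mathsf T}(G,X)=0$ for all $G\in\mathcal{G}$ implies $X\cong0$. A sequence $Y$ of modules is pure exact if $\operatorname{Hom}_R(N,Y)$ is exact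 for every finitely presented module $N$. A module $P$ is pure projective if $\operatorname{Hom}_R(P,-)$ preserves exactness of pure exact sequences. The left pure global dimension of $R$ is the least $d$ (or $\infty$) such that every left module $N$ has a pure exact sequence $0\to P_d\to\cdots\to P_0\to N\to0$ with all $P_i$ pure projective. *)

(* Defs.v *)
From HB Require Import structures.
From mathcomp Require Import all_boot all_order all_algebra.
From mathcomp Require Import boolp classical_sets functions cardinality fsbigop.

Set Implicit Arguments.
Unset Strict Implicit.
Unset Printing Implicit Defensive.
Local Obligation Tactic := idtac.

Import GRing.Theory.
Local Open Scope classical_set_scope.
Local Open Scope ring_scope.

Lemma linear_ext (R : pzRingType) (U V : lmodType R) (f g : {linear U -> V}) :
  f =1 g -> f = g.
Proof.
case: f => f [[hf1] [hf2]]; case: g => g [[hg1] [hg2]] /= e.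
have {}e : f = g by apply: funext.
case: _ / e hg1 hg2 => hg1 hg2.
by rewrite (Prop_irrelevance hf1 hg1) (Prop_irrelevance hf2 hg2).
Qed.

(** Direct sums: finitely supported families.  "Sets" are represented by
    [choiceType]s; as direct sums indexed by them are again modules, their
    universe is that of the carriers of modules. *)

Section DirectSum.
Variables (I : choiceType) (A : I -> zmodType).

Record dsum := DSum {
  dsum_val :> forall i, A i;
  dsum_fin : finite_set [set i | dsum_val i != 0] }.

HB.instance Definition _ := gen_eqMixin dsum.
HB.instance Definition _ := gen_choiceMixin dsum.

Lemma dsum_ext (f g : dsum) : (forall i, f i = g i) -> f = g.
Proof.
case: f => f hf; case: g => g hg /= e.
have {}e : f = g by apply: functional_extensionality_dep.
by case: _ / e hg => hg; rewrite (Prop_irrelevance hf hg).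
Qed.

Lemma dsum0_fin : finite_set [set i | (0 : A i) != 0].
Proof. by apply: (sub_finite_set _ (@finite_set0 I)) => i /=; rewrite eqxx. Qed.

Lemma dsumD_fin (f g : dsum) : finite_set [set i | f i + g i != 0].
Proof.
apply: (@sub_finite_set _ _ ([set i | f i != 0] `|` [set i | g i != 0])).
  move=> i /=; case: (eqVneq (f i) 0) => [->|]; last by left.
  by rewrite add0r; right.
by rewrite finite_setU; split; apply: dsum_fin.
Qed.

Lemma dsumN_fin (f : dsum) : finite_set [set i | - f i != 0].
Proof.
by apply: (sub_finite_set _ (dsum_fin f)) => i /=; rewrite oppr_eq0.
Qed.

Definition dsum_zero := DSum dsum0_fin.
Definition dsum_add f g := DSum (dsumD_fin f g).
Definition dsum_opp f := DSum (dsumN_fin f).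

Lemma dsum_addA : associative dsum_add.
Proof. by move=> f g h; apply: dsum_ext => i /=; rewrite addrA. Qed.
Lemma dsum_addC : commutative dsum_add.
Proof. by move=> f g; apply: dsum_ext => i /=; rewrite addrC. Qed.
Lemma dsum_add0 : left_id dsum_zero dsum_add.
Proof. by move=> f; apply: dsum_ext => i /=; rewrite add0r. Qed.
Lemma dsum_addN : left_inverse dsum_zero dsum_opp dsum_add.
Proof. by move=> f; apply: dsum_ext => i /=; rewrite addNr. Qed.

HB.instance Definition _ :=
  GRing.isZmodule.Build dsum dsum_addA dsum_addC dsum_add0 dsum_addN.
End DirectSum.

Section DirectSumModule.
Variables (R : pzRingType) (I : choiceType) (A : I -> lmodType R).

Lemma dsumZ_fin (a : R) (f : dsum A) : finite_set [set i | a *: f i != 0].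
Proof.
apply: (sub_finite_set _ (dsum_fin f)) => i /=.
by apply: contra => /eqP ->; rewrite scaler0.
Qed.

Definition dsum_scale a f : dsum A := DSum (dsumZ_fin a f).

Lemma dsum_scaleA a b f :
  dsum_scale a (dsum_scale b f) = dsum_scale (a * b) f.
Proof. by apply: dsum_ext => i /=; rewrite scalerA. Qed.
Lemma dsum_scale1 : left_id 1 dsum_scale.
Proof. by move=> f; apply: dsum_ext => i /=; rewrite scale1r. Qed.
Lemma dsum_scaleDr : right_distributive dsum_scale +%R.
Proof. by move=> a f g; apply: dsum_ext => i /=; rewrite scalerDr. Qed.
Lemma dsum_scaleDl f : {morph dsum_scale^~ f : a b / a + b}.
Proof. by move=> a b; apply: dsum_ext => i /=; rewrite scalerDl. Qed.

HB.instance Definition _ :=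
  GRing.Zmodule_isLmodule.Build R (dsum A)
    dsum_scaleA dsum_scale1 dsum_scaleDr dsum_scaleDl.
End DirectSumModule.

(** Right [R]-modules are left modules over the converse ring [R^c]. *)

Record bimodule (R : pzRingType) := Bimodule {
  bim_left : lmodType R;
  bim_act : bim_left -> R -> bim_left;
  bim_actA : forall x a b, bim_act (bim_act x a) b = bim_act x (a * b);
  bim_act1 : forall x, bim_act x 1 = x;
  bim_actDl : forall x y a, bim_act (x + y) a = bim_act x a + bim_act y a;
  bim_actDr : forall x a b, bim_act x (a + b) = bim_act x a + bim_act x b;
  bim_actZ : forall a x b, bim_act (a *: x) b = a *: bim_act x b }.

Definition bim_right_sort (R : pzRingType) (M : bimodule R) : Type :=
  bim_left M.

Section BimoduleRight.
Variables (R : pzRingType) (M : bimodule R).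

HB.instance Definition _ := GRing.Zmodule.on (bim_right_sort M).

Definition bim_scale (a : R^c) (x : bim_right_sort M) : bim_right_sort M :=
  bim_act x a.

Lemma bim_scaleA a b x : bim_scale a (bim_scale b x) = bim_scale (a * b) x.
Proof. exact: bim_actA. Qed.
Lemma bim_scale1 : left_id 1 bim_scale.
Proof. exact: bim_act1. Qed.
Lemma bim_scaleDr : right_distributive bim_scale +%R.
Proof. by move=> a x y; apply: bim_actDl. Qed.
Lemma bim_scaleDl x : {morph bim_scale^~ x : a b / a + b}.
Proof. by move=> a b; apply: bim_actDr. Qed.

HB.instance Definition _ :=
  GRing.Zmodule_isLmodule.Build R^c (bim_right_sort M)
    bim_scaleA bim_scale1 bim_scaleDr bim_scaleDl.

Definition bim_right : lmodType R^c := bim_right_sort M.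
End BimoduleRight.

Section Modules.
Variable R : pzRingType.
Implicit Types M N P F : lmodType R.

Definition isomorphic M N := exists f : {linear M -> N}, bijective f.

Definition zero_module M := forall x : M, x = 0.

Definition surjective (A B : Type) (f : A -> B) := forall b, exists a, f a = b.

Definition finitely_generated M :=
  exists n (p : {linear 'rV[R]_n -> M}), surjective p.

Definition finitely_presented M :=
  exists m n (r : {linear 'rV[R]_m -> 'rV[R]_n}) (p : {linear 'rV[R]_n -> M}),
    surjective p /\ forall x, p x = 0 <-> exists y, r y = x.

Definition projective P :=
  forall (B C : lmodType R) (g : {linear B -> C}) (f : {linear P -> C}),
    surjective g -> exists h : {linear P -> B}, forall x, g (h x) = f x.

Definition Add M N :=
  exists (I : choiceType) (N' : lmodType R),
    isomorphic (N * N')%type (dsum (fun _ : I => M)).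

(** Tensor products [A (x)_R F], for [A] a right module, are given by their
    universal property. *)

Definition balanced (A : lmodType R^c) F (T : zmodType) (t : A -> F -> T) :=
  [/\ forall a b x, t (a + b) x = t a x + t b x,
      forall a x y, t a (x + y) = t a x + t a y &
      forall (r : R) a x, t ((r : R^c) *: a) x = t a (r *: x)].

Definition is_tensor (A : lmodType R^c) F (T : zmodType) (t : A -> F -> T) :=
  balanced t /\
  forall (G : zmodType) (g : A -> F -> G), balanced g ->
    exists! h : {additive T -> G}, forall a x, h (t a x) = g a x.

(** [u (x) F] is injective for every injective [u]. *)
Definition flat F :=
  forall (A B : lmodType R^c) (u : {linear A -> B}), injective u ->
  forall (TA TB : zmodType) (tA : A -> F -> TA) (tB : B -> F -> TB),
    is_tensor tA -> is_tensor tB ->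
  forall h : {additive TA -> TB},
    (forall a x, h (tA a x) = tB (u a) x) -> injective h.

End Modules.

Definition right_coherent (R : pzRingType) :=
  forall (J : lmodType R^c) (i : {linear J -> (R^c)^o}),
    injective i -> finitely_generated J -> finitely_presented J.

Section Complexes.
Variable R : pzRingType.

(** The differential in degree [i + 1] is indexed by [i]; as [i] ranges over
    all integers this covers every degree, and composites typecheck without
    transport. *)
Record complex := Complex {
  cx_obj :> int -> lmodType R;
  cx_d : forall i, {linear cx_obj (i + 1) -> cx_obj i};
  cx_dd : forall i x, cx_d i (cx_d (i + 1) x) = 0 }.

Definition exact (Y : complex) :=
  forall i (x : Y (i + 1)), cx_d Y i x = 0 -> exists y, cx_d Y (i + 1) y = x.

(** Exactness of the complex of abelian groups [Hom_R(N, Y)]. *)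
Definition hom_exact (N : lmodType R) (Y : complex) :=
  forall i (f : {linear N -> Y (i + 1)}), (forall x, cx_d Y i (f x) = 0) ->
    exists g : {linear N -> Y (i + 1 + 1)}, forall x, cx_d Y (i + 1) (g x) = f x.

Definition pure_exact (Y : complex) :=
  forall N : lmodType R, finitely_presented N -> hom_exact N Y.

Definition pure_projective (P : lmodType R) :=
  forall Y : complex, pure_exact Y -> hom_exact P Y.

(** A sequence [0 -> P_d -> ... -> P_0 -> N -> 0] is a complex, extended by
    zero modules, with [N] in degree [0] and [P_i] in degree [i + 1]. *)
Definition resolution (P : lmodType R -> Prop) (d : nat) (N : lmodType R)
    (Y : complex) :=
  [/\ isomorphic (Y 0) N,
      forall i : nat, (i <= d)%N -> P (Y (i.+1)%:Z) &
      forall i : int, (i < 0)%R || (d.+1%:Z < i)%R -> zero_module (Y i)].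

Definition finite_projective_dimension (N : lmodType R) :=
  exists d Y, exact Y /\ resolution (@projective R) d N Y.

Definition finite_pure_global_dimension :=
  exists d, forall N : lmodType R,
    exists Y, pure_exact Y /\ resolution pure_projective d N Y.

End Complexes.

(** Preadditive categories.  Compactness and compact generation of a
    triangulated category refer only to its underlying preadditive category. *)

Record preadditive := Preadditive {
  ob :> Type;
  hom : ob -> ob -> zmodType;
  idm : forall X, hom X X;
  comp : forall X Y Z, hom Y Z -> hom X Y -> hom X Z;
  compA : forall X Y Z W (h : hom Z W) (g : hom Y Z) (f : hom X Y),
    comp h (comp g f) = comp (comp h g) f;
  comp1m : forall X Y (f : hom X Y), comp (idm Y) f = f;
  compm1 : forall X Y (f : hom X Y), comp f (idm X) = f;
  compDl : forall X Y Z (g g' : hom Y Z) (f : hom X Y),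
    comp (g + g') f = comp g f + comp g' f;
  compDr : forall X Y Z (g : hom Y Z) (f f' : hom X Y),
    comp g (f + f') = comp g f + comp g f' }.

Section CompactGeneration.
Variable T : preadditive.

Definition is_coproduct (I : choiceType) (X : I -> T) (S : T)
    (j : forall i, hom (X i) S) :=
  forall (Y : T) (g : forall i, hom (X i) Y),
    exists! h : hom S Y, forall i, comp h (j i) = g i.

Definition has_coproducts :=
  forall (I : choiceType) (X : I -> T),
    exists (S : T) (j : forall i, hom (X i) S), is_coproduct j.

Definition compact (C : T) :=
  forall (I : choiceType) (X : I -> T) (S : T) (j : forall i, hom (X i) S),
    is_coproduct j ->
    bijective (fun f : dsum (fun i => hom C (X i)) =>
                 \sum_(i \in [set: I]) comp (j i) (f i)).

Definition zero_object (X : T) :=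
  forall Y : T, (forall f g : hom X Y, f = g) /\ (forall f g : hom Y X, f = g).

Definition compactly_generated :=
  has_coproducts /\
  exists (J : choiceType) (G : J -> T),
    (forall j, compact (G j)) /\
    forall X : T, (forall j (f : hom (G j) X), f = 0) -> zero_object X.

End CompactGeneration.

Section ChainMaps.
Variable R : pzRingType.
Implicit Types C D E : complex R.

Record chain_map C D := ChainMap {
  cm :> forall i, {linear C i -> D i};
  cm_comm : forall i x, cm i (cx_d C i x) = cx_d D i (cm (i + 1) x) }.

Lemma cm_ext C D (f g : chain_map C D) : (forall i, f i =1 g i) -> f = g.
Proof.
case: f => f hf; case: g => g hg /= e.
have {}e : f = g.
  by apply: functional_extensionality_dep => i; apply/linear_ext/e.
by case: _ / e hg => hg; rewrite (Prop_irrelevance hf hg).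
Qed.

Section Zmodule.
Variables C D : complex R.

HB.instance Definition _ := gen_eqMixin (chain_map C D).
HB.instance Definition _ := gen_choiceMixin (chain_map C D).

Program Definition cm0 : chain_map C D := @ChainMap C D (fun i => \0) _.
Next Obligation. by move=> i x /=; rewrite raddf0. Qed.

Program Definition cm_add (f g : chain_map C D) : chain_map C D :=
  @ChainMap C D (fun i => f i \+ g i) _.
Next Obligation. by move=> f g i x /=; rewrite !cm_comm raddfD. Qed.

Program Definition cm_opp (f : chain_map C D) : chain_map C D :=
  @ChainMap C D (fun i => \- f i) _.
Next Obligation. by move=> f i x /=; rewrite cm_comm raddfN. Qed.

Lemma cm_addA : associative cm_add.
Proof. by move=> f g h; apply: cm_ext => i x /=; rewrite addrA. Qed.
Lemma cm_addC : commutative cm_add.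
Proof. by move=> f g; apply: cm_ext => i x /=; rewrite addrC. Qed.
Lemma cm_add0 : left_id cm0 cm_add.
Proof. by move=> f; apply: cm_ext => i x /=; rewrite add0r. Qed.
Lemma cm_addN : left_inverse cm0 cm_opp cm_add.
Proof. by move=> f; apply: cm_ext => i x /=; rewrite addNr. Qed.

HB.instance Definition _ :=
  GRing.isZmodule.Build (chain_map C D) cm_addA cm_addC cm_add0 cm_addN.

(** Stated in degree [i + 1], see [complex]. *)
Definition null_homotopic (f : chain_map C D) :=
  exists s : forall i, {linear C i -> D (i + 1)},
    forall i x, f (i + 1) x = cx_d D (i + 1) (s (i + 1) x) + s i (cx_d C i x).

Definition null_htpy : {pred chain_map C D} :=
  fun f => `[< null_homotopic f >].

Lemma null_htpy_zmod_closed : zmod_closed null_htpy.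
Proof.
split; first by apply/asboolP; exists (fun=> \0) => i x /=; rewrite raddf0 addr0.
move=> f g /asboolP[s hs] /asboolP[t ht]; apply/asboolP.
exists (fun i => s i \- t i) => i x /=.
by rewrite hs ht raddfB opprD addrACA.
Qed.

HB.instance Definition _ :=
  GRing.isZmodClosed.Build (chain_map C D) null_htpy null_htpy_zmod_closed.

(** Chain maps modulo homotopy. *)
Definition homK : zmodType := Quotient.quot null_htpy.

Definition cls (f : chain_map C D) : homK := \pi_homK%qT f.
End Zmodule.

Program Definition cm_id C : chain_map C C := @ChainMap C C (fun i => idfun) _.
Next Obligation. by []. Qed.

Program Definition cm_comp C D E (g : chain_map D E) (f : chain_map C D) :
  chain_map C E := @ChainMap C E (fun i => g i \o f i) _.
Next Obligation. by move=> C D E g f i x /=; rewrite !cm_comm. Qed.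

Section Homotopy.
Variables C D E : complex R.

Lemma null_htpy_compl (g : chain_map D E) (f : chain_map C D) :
  null_homotopic f -> null_homotopic (cm_comp g f).
Proof.
case=> s hs; exists (fun i => g (i + 1) \o s i) => i x /=.
by rewrite hs linearD /= cm_comm.
Qed.

Lemma null_htpy_compr (g : chain_map D E) (f : chain_map C D) :
  null_homotopic g -> null_homotopic (cm_comp g f).
Proof.
case=> s hs; exists (fun i => s i \o f i) => i x /=.
by rewrite hs /= cm_comm.
Qed.

Lemma cls_eq (f g : chain_map C D) : cls f = cls g <-> null_homotopic (f - g).
Proof.
rewrite /cls; split=> [/eqP|h]; first by rewrite -Quotient.idealrBE => /asboolP.
by apply/eqP; rewrite -Quotient.idealrBE; apply/asboolP.
Qed.

Lemma clsD (f g : chain_map C D) : cls (f + g) = cls f + cls g.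
Proof. by rewrite /cls raddfD. Qed.

End Homotopy.

Definition compK C D E (g : homK D E) (f : homK C D) : homK C E :=
  cls (cm_comp (repr g) (repr f)).

Lemma clsK C D (f : homK C D) : cls (repr f) = f.
Proof. exact: reprK. Qed.

Lemma compK_cls C D E (g : chain_map D E) (f : chain_map C D) :
  compK (cls g) (cls f) = cls (cm_comp g f).
Proof.
transitivity (cls (cm_comp g (repr (cls f)))).
  have /cls_eq/(@null_htpy_compr _ _ _ _ (repr (cls f))) h := clsK (cls g).
  apply/cls_eq; congr (null_homotopic _): h.
  by apply: cm_ext.
have /cls_eq/(@null_htpy_compl _ _ _ g) h := clsK (cls f).
apply/cls_eq; congr (null_homotopic _): h.
by apply: cm_ext => i x /=; rewrite raddfB.
Qed.

Lemma compKA C D E F (h : homK E F) (g : homK D E) (f : homK C D) :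
  compK h (compK g f) = compK (compK h g) f.
Proof.
rewrite -[h]clsK -[g]clsK -[f]clsK !compK_cls.
by congr cls; apply: cm_ext.
Qed.

Lemma compK1m C D (f : homK C D) : compK (cls (cm_id D)) f = f.
Proof. by rewrite -[f]clsK compK_cls; congr cls; apply: cm_ext. Qed.

Lemma compKm1 C D (f : homK C D) : compK f (cls (cm_id C)) = f.
Proof. by rewrite -[f]clsK compK_cls; congr cls; apply: cm_ext. Qed.

Lemma compKDl C D E (g g' : homK D E) (f : homK C D) :
  compK (g + g') f = compK g f + compK g' f.
Proof.
rewrite -[g]clsK -[g']clsK -[f]clsK -clsD !compK_cls -clsD.
by congr cls; apply: cm_ext.
Qed.

Lemma compKDr C D E (g : homK D E) (f f' : homK C D) :
  compK g (f + f') = compK g f + compK g f'.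
Proof.
rewrite -[g]clsK -[f]clsK -[f']clsK -clsD !compK_cls -clsD.
by congr cls; apply: cm_ext => i x /=; rewrite raddfD.
Qed.

End ChainMaps.

(** The homotopy category of complexes with components in the class [X]. *)
Definition K (R : pzRingType) (X : lmodType R -> Prop) : preadditive :=
  @Preadditive {C : complex R | forall i, X (C i)}
    (fun C D => homK (sval C) (sval D))
    (fun C => cls (cm_id (sval C)))
    (fun C D E => @compK R (sval C) (sval D) (sval E))
    (fun C D E F => @compKA R (sval C) (sval D) (sval E) (sval F))
    (fun C D => @compK1m R (sval C) (sval D))
    (fun C D => @compKm1 R (sval C) (sval D))
    (fun C D E => @compKDl R (sval C) (sval D) (sval E))
    (fun C D E => @compKDr R (sval C) (sval D) (sval E)).

(* Main.v *)
From HB Require Import structures.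
From mathcomp Require Import all_boot all_order all_algebra.
From mathcomp Require Import boolp classical_sets functions cardinality fsbigop.
From mathcomp Require Import zify.
Require Import Defs.

(** Let [Y] be a complex of modules from [Add M].

    Generators.  For [G] finitely presented, the right module [Hom (G, M)] is the
    kernel of a map between finite powers of the finitely presented right
    module [M], so right coherence makes it finitely generated ([hom_fg]).  A
    finite set of generators is a map [e : G -> M ^ k] through which every map
    from [G] to a module of [Add M] factors, an [Add M]-preenvelope
    ([add_preenvelope]).  Its cokernel is again finitely presented, so the
    construction can be iterated; splicing the steps gives a complex [X] of
    finite powers of [M], placed in degrees below a chosen integer (a tower,
    [tower_exists]).  A chain map from [X] to [Y] is determined up to homotopy
    by its restriction to [G] in the top degree ([tower_null]), and every
    cycle [G -> Y] arises in this way ([tower_extend]): maps from [X] to [Y] in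
    the homotopy category are a homology group of [Hom (G, Y)].  As [G] is
    finitely generated, [X] is compact ([tower_compact]); and if all these
    groups vanish then [Hom (G, Y)] is exact for all finitely presented [G],
    that is, [Y] is pure exact.  So compact generation follows once every pure
    exact [Y] is contractible ([K_Add_compactly_generated]).

    Contractibility.  Fix a class [N] of test modules, and with it the notions of
    epimorphism, projective and exact complex relative to [N].  Let [Y] be exact
    with projective terms in this sense, and suppose that each module of cycles of
    [Y] is a retract of a module of relative dimension at most [n], for one [n].
    A form of Schanuel's lemma, iterated [n] times along [Y], shows that all
    cycles are relative projective ([rel_proj_cycles]), hence that [Y] splits
    ([rel_contractible]).  If the pure global dimension is finite, take for [N]
    the pure projective modules ([pure_contractible]).  If [M] is projective,
    take the projective modules: the cycles of [Y] are flat because maps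
    from finitely presented modules to them factor through finite free ones
    ([cycles_flat]), and applying the hypothesis on flat modules to the
    direct sum of all the cycles gives one bound for all of them
    ([projective_contractible]).  The last assertion is the case [M = R], as
    [Add R] consists of the projective modules ([Add_regular]). *)

Set Implicit Arguments.
Unset Strict Implicit.
Unset Printing Implicit Defensive.

Import Order.TTheory GRing.Theory Num.Theory.
Local Open Scope classical_set_scope.
Local Open Scope ring_scope.

Lemma dep_choice (I : Type) (T : I -> Type) (P : forall i, T i -> Prop) :
  (forall i, exists x, P i x) -> exists f : forall i, T i, forall i, P i (f i).
Proof. by move=> h; exists (fun i => projT1 (cid (h i))) => i; case: (cid _). Qed.

(** * Submodules, quotients and linear maps *)

Section LinOf.
Variables (R : pzRingType) (U V : lmodType R) (f : U -> V) (hf : linear f).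

(** Bundles a function with a proof of its linearity; the proof is an argument of
    the constant, so that the canonical structure can find it. *)
Definition lin_of : U -> V := let _ := hf in f.

Lemma lin_of_is_linear : linear lin_of.
Proof. exact: hf. Qed.

HB.instance Definition _ := GRing.isLinear.Build R U V *:%R lin_of lin_of_is_linear.
End LinOf.

Section Sub.
Variables (R : pzRingType) (U : lmodType R).

Record submodule := Submodule {
  sub_mem :> U -> Prop;
  sub_closed : forall a x y, sub_mem x -> sub_mem y -> sub_mem (a *: x + y);
  sub_mem0 : sub_mem 0 }.

Definition in_sub (S : submodule) : {pred U} := fun x => `[< S x >].

Lemma in_subP (S : submodule) x : reflect (S x) (x \in in_sub S).
Proof. exact: asboolP. Qed.

Lemma in_sub_submod_closed S : submod_closed (in_sub S).
Proof.
split; first by apply/in_subP; apply: sub_mem0.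
by move=> a x y /in_subP hx /in_subP hy; apply/in_subP/sub_closed.
Qed.
HB.instance Definition _ S := GRing.isSubmodClosed.Build R U (in_sub S) (in_sub_submod_closed S).

Definition sub_module (S : submodule) := {x : U | x \in in_sub S}.
HB.instance Definition _ S := SubType.on (sub_module S).
HB.instance Definition _ S := Choice.on (sub_module S).
HB.instance Definition _ S :=
  [SubChoice_isSubLmodule of sub_module S by <:].

End Sub.

Section SubModule.
Variables (R : pzRingType) (U : lmodType R) (S : submodule U).

Definition sub_incl : sub_module S -> U := val.
Lemma sub_incl_linear : linear sub_incl.
Proof. by move=> a x y; rewrite /sub_incl linearP. Qed.
HB.instance Definition _ := GRing.isLinear.Build R _ U *:%R sub_incl sub_incl_linear.

Lemma sub_inclP (z : sub_module S) : S (sub_incl z).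
Proof. by apply/in_subP; apply: valP. Qed.

Lemma sub_incl_inj : injective sub_incl.
Proof. exact: val_inj. Qed.

Variables (V : lmodType R) (f : {linear V -> U}) (hf : forall x, S (f x)).

Definition sub_corestr (x : V) : sub_module S := Sub (f x) (introT (in_subP S (f x)) (hf x)).
Lemma sub_corestr_linear : linear sub_corestr.
Proof. by move=> a x y; apply: val_inj; rewrite /= linearP. Qed.
HB.instance Definition _ := GRing.isLinear.Build R _ _ *:%R sub_corestr sub_corestr_linear.

Lemma sub_corestrE x : sub_incl (sub_corestr x) = f x. Proof. by []. Qed.
End SubModule.

Section KerIm.
Variables (R : pzRingType) (U V : lmodType R) (f : {linear U -> V}).

Lemma ker_closed (a : R) x y : f x = 0 -> f y = 0 -> f (a *: x + y) = 0.
Proof. by move=> hx hy; rewrite linearP hx hy scaler0 addr0. Qed.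
Definition ker := @Submodule R U (fun x => f x = 0) ker_closed (linear0 f).

Lemma im_closed (a : R) x y :
  (exists z, f z = x) -> (exists z, f z = y) -> exists z, f z = a *: x + y.
Proof. by move=> [z <-] [t <-]; exists (a *: z + t); rewrite linearP. Qed.
Lemma im0 : exists z, f z = 0. Proof. by exists 0; rewrite linear0. Qed.
Definition im := @Submodule R V (fun y => exists z, f z = y) im_closed im0.
End KerIm.

Section Quot.
Variables (R : pzRingType) (U : lmodType R) (S : submodule U).

Definition quot_module : Type := Quotient.quot (in_sub S).
HB.instance Definition _ := GRing.Zmodule.on quot_module.

Definition quot_proj (x : U) : quot_module := \pi_(Quotient.quot (in_sub S))%qT x.

Lemma quot_proj_eq x y : quot_proj x = quot_proj y <-> S (x - y).
Proof.
rewrite /quot_proj; split=> [/eqP|h].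
  by rewrite -Quotient.idealrBE => /in_subP.
by apply/eqP; rewrite -Quotient.idealrBE; apply/in_subP.
Qed.

Lemma quot_proj_surj (z : quot_module) : exists x, quot_proj x = z.
Proof. exists (repr z); exact: (@reprK _ (Quotient.quot (in_sub S))). Qed.

Lemma quot_projD x y : quot_proj (x + y) = quot_proj x + quot_proj y.
Proof. by rewrite /quot_proj raddfD. Qed.

Definition qscale (a : R) (z : quot_module) :=
  quot_proj (a *: repr (z : Quotient.quot (in_sub S))).

Lemma qscaleE a x : qscale a (quot_proj x) = quot_proj (a *: x).
Proof.
apply/quot_proj_eq; rewrite -scalerBr -[_ *: _]addr0; apply: sub_closed; last exact: sub_mem0.
by apply/quot_proj_eq; rewrite /quot_proj reprK.
Qed.

Lemma qscaleA a b f : qscale a (qscale b f) = qscale (a * b) f.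
Proof. by have [x <-] := quot_proj_surj f; rewrite !qscaleE scalerA. Qed.
Lemma qscale1 : left_id 1 qscale.
Proof. by move=> f; have [x <-] := quot_proj_surj f; rewrite !qscaleE scale1r. Qed.
Lemma qscaleDr : right_distributive qscale +%R.
Proof.
move=> a f g; have [x <-] := quot_proj_surj f; have [y <-] := quot_proj_surj g.
by rewrite -quot_projD !qscaleE scalerDr quot_projD.
Qed.
Lemma qscaleDl f : {morph qscale^~ f : a b / a + b}.
Proof. by move=> a b; have [x <-] := quot_proj_surj f; rewrite !qscaleE scalerDl quot_projD. Qed.

HB.instance Definition _ :=
  GRing.Zmodule_isLmodule.Build R quot_module qscaleA qscale1 qscaleDr qscaleDl.

Lemma quot_proj_linear : linear quot_proj.
Proof. by move=> a x y; rewrite quot_projD -qscaleE. Qed.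
HB.instance Definition _ := GRing.isLinear.Build R U quot_module *:%R quot_proj quot_proj_linear.

Lemma quot_proj_eq0 x : quot_proj x = 0 <-> S x.
Proof. by rewrite -(linear0 quot_proj) quot_proj_eq subr0. Qed.
End Quot.

Section LinComb.
Variables (R : pzRingType) (V : lmodType R) (n : nat) (v : 'I_n -> V).
Definition lincomb (c : 'rV[R]_n) := \sum_i c 0 i *: v i.
Lemma lincomb_linear : linear lincomb.
Proof.
move=> a x y; rewrite /lincomb scaler_sumr -big_split /=.
by apply: eq_bigr => i _; rewrite !mxE scalerDl scalerA.
Qed.
HB.instance Definition _ := GRing.isLinear.Build R _ _ *:%R lincomb lincomb_linear.

Lemma lincomb_delta i : lincomb (delta_mx 0 i) = v i.
Proof.
rewrite /lincomb (bigD1 i) //= mxE !eqxx scale1r big1 ?addr0 // => j ji.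
by rewrite mxE (negPf ji) andbF scale0r.
Qed.
End LinComb.

Lemma lincombE (R : pzRingType) (V : lmodType R) n (f : {linear 'rV[R]_n -> V}) c :
  f c = lincomb (fun i => f (delta_mx 0 i)) c.
Proof.
by rewrite {1}[c]row_sum_delta linear_sum; apply: eq_bigr => i _; rewrite linearZ.
Qed.

(** Choose preimages: linearity holds because two choices differ by an element of
    the kernel of [p]. *)
Lemma factor_surj (R : pzRingType) (U V W : lmodType R)
    (p : {linear U -> V}) (f : {linear U -> W}) :
  surjective p -> (forall x, p x = 0 -> f x = 0) ->
  exists g : {linear V -> W}, forall x, g (p x) = f x.
Proof.
move=> sp hk; have [s hs] := choice sp.
have hE x : f (s (p x)) = f x.
  by apply/eqP; rewrite -subr_eq0 -linearB; apply/eqP/hk; rewrite linearB /= hs subrr.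
have lin : linear (f \o s).
  move=> a x y /=; have [x' <-] := sp x; have [y' <-] := sp y.
  by rewrite -linearP !hE linearP.
by exists (lin_of lin) => x; rewrite /= /lin_of /= hE.
Qed.

Lemma factor_inj (R : pzRingType) (K P V : lmodType R) (u : {linear K -> P})
    (f : {linear V -> P}) : injective u -> (forall x, exists y, u y = f x) ->
  exists h : {linear V -> K}, forall x, u (h x) = f x.
Proof.
move=> iu /choice [h hh].
have hl : linear h by move=> a x y; apply: iu; rewrite linearP !hh linearP.
by exists (lin_of hl).
Qed.

Lemma free_lift (R : pzRingType) n (B C : lmodType R)
    (g : {linear B -> C}) (f : {linear 'rV[R]_n -> C}) :
  (forall i, exists b, g b = f (delta_mx 0 i)) ->
  exists h : {linear 'rV[R]_n -> B}, forall x, g (h x) = f x.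
Proof.
move=> /choice [s hs]; exists (lincomb s) => x.
rewrite (lincombE f) /lincomb linear_sum.
by apply: eq_bigr => i _; rewrite linearZ /= hs.
Qed.

Lemma free_copair (R : pzRingType) m n (B : lmodType R)
    (f : {linear 'rV[R]_m -> B}) (g : {linear 'rV[R]_n -> B}) :
  exists h : {linear 'rV[R]_(m + n) -> B},
    forall c, h c = f (lsubmx c) + g (rsubmx c).
Proof.
have lin : linear (fun c : 'rV[R]_(m + n) => f (lsubmx c) + g (rsubmx c)).
  by move=> a x y; rewrite !linearP scalerDr addrACA.
by exists (lin_of lin).
Qed.

(** * Direct sums *)

Section DsumMaps.
Variables (R : pzRingType) (I : choiceType) (A : I -> lmodType R).

Definition dsum_proj (i : I) (x : dsum A) : A i := x i.
Lemma dsum_proj_linear i : linear (dsum_proj i). Proof. by []. Qed.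
HB.instance Definition _ i := GRing.isLinear.Build R _ _ *:%R (dsum_proj i) (dsum_proj_linear i).

Lemma dsum_single_fin i (a : A i) : finite_set [set j | dfwith (fun j => 0 : A j) a j != 0].
Proof.
apply: (sub_finite_set _ (finite_set1 i)) => j /=.
by case: dfwithP => [|k ki]; rewrite ?eqxx.
Qed.
Definition dsum_single i (a : A i) : dsum A := DSum (dsum_single_fin a).

Lemma dsum_single_in i (a : A i) : dsum_single a i = a. Proof. exact: dfwith_in. Qed.
Lemma dsum_single_out i j (a : A i) : i != j -> dsum_single a j = 0.
Proof. exact: dfwith_out. Qed.

Lemma dsum_single_linear i : linear (@dsum_single i).
Proof.
move=> c a b; apply: dsum_ext => j.
pose D (x : A i) := dfwith (fun j => 0 : A j) x j.
rewrite -[LHS]/(D (c *: a + b)) -[RHS]/(c *: D a + D b) /D.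
have [<-|ij] := eqVneq i j; first by rewrite !dfwith_in.
by rewrite !dfwith_out // scaler0 addr0.
Qed.
HB.instance Definition _ i :=
  GRing.isLinear.Build R _ _ *:%R (@dsum_single i) (@dsum_single_linear i).
Definition dsum_incl i : {linear A i -> dsum A} := @dsum_single i.

Definition dsum_supp (x : dsum A) : seq I := finmap.enum_fset (fset_set [set i | x i != 0]).
Lemma dsum_suppP (x : dsum A) i : (i \in dsum_supp x) = (x i != 0).
Proof.
rewrite /dsum_supp; have := in_fset_set (dsum_fin x) i.
rewrite /= => ->; apply/idP/idP; first by rewrite inE.
by move=> h; rewrite inE.
Qed.
Lemma dsum_supp_uniq x : uniq (dsum_supp x).
Proof. by rewrite /dsum_supp finmap.fset_uniq. Qed.

Lemma dsum_sum (T : Type) (r : seq T) (P : pred T) (F : T -> dsum A) i :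
  (\sum_(t <- r | P t) F t) i = \sum_(t <- r | P t) F t i.
Proof. exact: (linear_sum (dsum_proj i)). Qed.

Lemma dsum_decomp (x : dsum A) (s : seq I) : uniq s ->
  (forall i, x i != 0 -> i \in s) -> x = \sum_(i <- s) dsum_single (x i).
Proof.
move=> us hs; apply: dsum_ext => i; rewrite dsum_sum.
have [xi|/hs si] := eqVneq (x i) 0; last first.
  rewrite (bigD1_seq i) //= [X in _ + X]big1 ?addr0 ?dfwith_in // => j ji.
  by rewrite dfwith_out.
rewrite xi big1 // => j _; have [->|ji] := eqVneq j i.
  by rewrite -[LHS]/(dsum_single (x i) i) dsum_single_in.
exact: dsum_single_out.
Qed.

Section Copair.
Variables (V : lmodType R) (f : forall i, {linear A i -> V}).
Definition dsum_copair (x : dsum A) : V := \sum_(i <- dsum_supp x) f i (x i).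
Lemma dsum_copairE (x : dsum A) s : uniq s -> (forall i, x i != 0 -> i \in s) ->
  dsum_copair x = \sum_(i <- s) f i (x i).
Proof.
move=> us hs; rewrite /dsum_copair.
rewrite [RHS](bigID (fun i => x i != 0)) /= [X in _ + X]big1 ?addr0; last first.
  by move=> i /negPn/eqP ->; rewrite linear0.
rewrite -[RHS]big_filter; apply: perm_big; apply: uniq_perm.
- exact: dsum_supp_uniq.
- exact: filter_uniq.
- move=> i; rewrite dsum_suppP mem_filter; apply/idP/idP; last by case/andP.
  by move=> h; rewrite h hs.
Qed.

Lemma dsum_copair_linear : linear dsum_copair.
Proof.
move=> a x y.
pose s := undup (dsum_supp x ++ dsum_supp y).
have us : uniq s by apply: undup_uniq.
have sx i : x i != 0 -> i \in s by rewrite mem_undup mem_cat -dsum_suppP => ->.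
have sy i : y i != 0 -> i \in s by rewrite mem_undup mem_cat -(dsum_suppP y) => ->; rewrite orbT.
rewrite (dsum_copairE us sx) (dsum_copairE us sy) (@dsum_copairE _ s) //; last first.
  move=> i; rewrite -[(a *: x + y) i]/(a *: x i + y i).
  have [->|/sx //] := eqVneq (x i) 0.
  by rewrite scaler0 add0r => /sy.
rewrite scaler_sumr -big_split; apply: eq_bigr => i _ /=.
by rewrite -linearP.
Qed.
HB.instance Definition _ := GRing.isLinear.Build R _ _ *:%R dsum_copair dsum_copair_linear.

Lemma dsum_copair_in i a : dsum_copair (dsum_single a) = f i a.
Proof.
rewrite (@dsum_copairE _ [:: i]) //.
  by rewrite big_seq1 dsum_single_in.
move=> j; rewrite inE; apply: contraR => ji.
by rewrite dsum_single_out // eq_sym.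
Qed.
End Copair.

(** A direct sum is generated by its summands. *)
Lemma dsum_lin_ext (V : lmodType R) (f g : {linear dsum A -> V}) :
  (forall i a, f (@dsum_single i a) = g (dsum_single a)) -> f =1 g.
Proof.
move=> h x; have -> : x = \sum_(i <- dsum_supp x) dsum_single (x i).
  by apply: dsum_decomp => [|i]; rewrite ?dsum_supp_uniq ?dsum_suppP.
by rewrite !linear_sum; apply: eq_bigr => i _; apply: h.
Qed.
End DsumMaps.

Lemma dsum_pair (R : pzRingType) (I : choiceType) (A : I -> lmodType R)
    (V : lmodType R) (f : forall i, {linear V -> A i}) :
  (forall x, finite_set [set i | f i x != 0]) ->
  exists g : {linear V -> dsum A}, forall x i, g x i = f i x.
Proof.
move=> hf; have lin : linear (fun x => DSum (hf x) : dsum A).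
  by move=> a x y; apply: dsum_ext => i /=; rewrite linearP.
by exists (lin_of lin).
Qed.

Section DsumMap.
Variables (R : pzRingType) (I : choiceType) (A B : I -> lmodType R).
Variable f : forall i, {linear A i -> B i}.
Lemma dsum_map_fin (x : dsum A) : finite_set [set i | f i (x i) != 0].
Proof.
apply: (sub_finite_set _ (dsum_fin x)) => i /=.
by apply: contra => /eqP ->; rewrite linear0.
Qed.
Definition dsum_map (x : dsum A) : dsum B := DSum (dsum_map_fin x).
Lemma dsum_map_linear : linear dsum_map.
Proof. by move=> a x y; apply: dsum_ext => i /=; rewrite linearP. Qed.
HB.instance Definition _ := GRing.isLinear.Build R _ _ *:%R dsum_map dsum_map_linear.

Lemma dsum_map_in i a : dsum_map (@dsum_single _ _ A i a) = dsum_single (f i a).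
Proof.
apply: dsum_ext => j /=; have [<-|ij] := eqVneq i j; first by rewrite !dfwith_in.
by rewrite !dfwith_out // linear0.
Qed.
End DsumMap.

(** The finitely many generators have a common finite support. *)
Lemma fg_dsum_supp (R : pzRingType) (G : lmodType R) (I : choiceType) (A : I -> lmodType R)
    (f : {linear G -> dsum A}) : finitely_generated G ->
  exists s : seq I, uniq s /\ forall x i, f x i != 0 -> i \in s.
Proof.
move=> [n [p sp]].
exists (undup (flatten [seq dsum_supp (f (p (delta_mx 0 j))) | j <- enum 'I_n])).
split; first exact: undup_uniq.
move=> x i; have [y <-] := sp x; apply: contraR => hi.
rewrite (lincombE p) /lincomb linear_sum dsum_sum; apply/eqP/big1 => j _.
rewrite linearZ -[LHS]/(y 0 j *: _ i).
suff -> : f (p (delta_mx 0 j)) i = 0 by rewrite scaler0.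
apply/eqP; rewrite -[_ == _]negbK -dsum_suppP; apply: contra hi => hi.
rewrite mem_undup; apply/flattenP; eexists; last exact: hi.
by apply/mapP; exists j; rewrite ?mem_enum.
Qed.

(** * Finitely generated kernels over a coherent ring *)

Definition fg_pred (R : pzRingType) (B : lmodType R) (V : B -> Prop) :=
  exists n (p : {linear 'rV[R]_n -> B}), forall x, V x <-> exists c, p c = x.

(** Schanuel's lemma in terms of elements.  Compare [q] with the cover [p] of a
    finite presentation by lifts [al] of [p] and [be] of [q].  The kernel of [q] is generated
    by the images under [al] of the relations of the presentation and by the vectors
    [x - al (be x)], which measure the difference of the two free covers. *)
Lemma fp_ker_fg (R : pzRingType) (A : lmodType R) n (q : {linear 'rV[R]_n -> A}) :
  finitely_presented A -> surjective q -> fg_pred (fun x => q x = 0).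
Proof.
move=> [m [n' [r [p [sp hp]]]]] sq.
have [al hal] : exists al : {linear 'rV[R]_n' -> 'rV[R]_n}, forall x, q (al x) = p x.
  by apply: free_lift => i; apply: sq.
have [be hbe] : exists be : {linear 'rV[R]_n -> 'rV[R]_n'}, forall x, p (be x) = q x.
  by apply: free_lift => i; apply: sp.
have [h hh] := free_copair (al \o r) (idfun \- (al \o be)).
exists (m + n)%N, h => x; split=> [qx|[c <-]].
  have [y hy] : exists y, r y = be x by apply/hp; rewrite hbe.
  by exists (row_mx y x); rewrite hh row_mxKl row_mxKr /= hy addrC subrK.
rewrite hh /= linearD linearB /= !hal hbe subrr addr0.
by apply/hp; exists (lsubmx c).
Qed.

(** Pull the kernel of [f] back to a free module covering [V]. *)
Lemma fg_ker_cap (R : pzRingType) (A B : lmodType R) (V : B -> Prop) (f : {linear B -> A}) :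
  (forall n (g : {linear 'rV[R]_n -> A}), fg_pred (fun x => g x = 0)) ->
  fg_pred V -> fg_pred (fun x => V x /\ f x = 0).
Proof.
move=> hA [n [p hp]]; have [k [q hq]] := hA n (f \o p).
exists k, (p \o q) => x; split=> [[/hp [c <-] fp]|[c <-]] /=.
  by have [d <-] : exists d, q d = c by [apply/hq]; exists d.
by split; [apply/hp; exists (q c)|apply/hq; exists c].
Qed.

Lemma fg_ker_bigcap (R : pzRingType) (A B : lmodType R) (V : B -> Prop)
    (T : eqType) (s : seq T) (F : T -> {linear B -> A}) :
  (forall n (g : {linear 'rV[R]_n -> A}), fg_pred (fun x => g x = 0)) ->
  fg_pred V -> fg_pred (fun x => V x /\ forall t, t \in s -> F t x = 0).
Proof.
move=> hA hV; elim: s => [|t s IH].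
  have [n [p hp]] := hV; exists n, p => x; rewrite -hp.
  by split=> [[]|].
have [n [p hp]] := fg_ker_cap (F t) hA IH; exists n, p => x; rewrite -hp.
split=> [[Vx h]|[[Vx h] ht]].
  by split; [split=> // u us; apply: h; rewrite inE us orbT|apply: h; rewrite inE eqxx].
by split=> // u; rewrite inE => /orP[/eqP ->|/h].
Qed.

Section Coherent.
Variable R : pzRingType.
Hypothesis coh : forall (J : lmodType R) (i : {linear J -> R^o}),
  injective i -> finitely_generated J -> finitely_presented J.

(** The image of [f] is a finitely generated ideal, finitely presented by coherence;
    then [fp_ker_fg] applies to the map from the free module onto it. *)
Lemma coherent_ker1 n (f : {linear 'rV[R]_n -> R^o}) : fg_pred (fun x => f x = 0).
Proof.
pose q := sub_corestr (S := im f) (fun x => ex_intro _ x erefl).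
have sq : surjective q.
  by move=> z; have [x hx] := sub_inclP z; exists x; apply: sub_incl_inj.
have [m [p hp]] : fg_pred (fun x => q x = 0).
  apply: fp_ker_fg => //; apply: (coh (@sub_incl_inj _ _ (im f))).
  by exists n, q.
exists m, p => x; rewrite -hp; split=> [fx|/(congr1 (@sub_incl _ _ _))].
  by apply: sub_incl_inj; rewrite linear0 sub_corestrE.
by rewrite linear0 sub_corestrE.
Qed.

(** The kernel is the intersection of the kernels of the [k] coordinates. *)
Lemma coherent_ker_free n k (f : {linear 'rV[R]_n -> 'rV[R]_k}) :
  fg_pred (fun x => f x = 0).
Proof.
have lin (j : 'I_k) : linear (fun x => f x 0 j : R^o).
  by move=> a x y; rewrite linearP !mxE.
have [|m [p hp]] := @fg_ker_bigcap _ _ _ (fun=> True) _ (enum 'I_k) (fun j => lin_of (lin j))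
  coherent_ker1.
  by exists n, idfun => x; split=> // _; exists x.
exists m, p => x; rewrite -hp; split=> [fx|[_ fx]].
  by split=> // t _; rewrite /= /lin_of fx mxE.
by apply/rowP => j; rewrite mxE; apply: fx; rewrite mem_enum.
Qed.

(** Lift [f] to [F] along a presentation of [A] by [q] with relations [r].  A vector
    is killed by [f] when its image under [F] is a relation, so the kernel is a
    projection of the kernel of the map [(F, r)] between free modules. *)
Lemma coherent_ker_fp (A : lmodType R) n (f : {linear 'rV[R]_n -> A}) :
  finitely_presented A -> fg_pred (fun x => f x = 0).
Proof.
move=> [m [n' [r [q [sq hq]]]]].
have [F hF] : exists F : {linear 'rV[R]_n -> 'rV[R]_n'}, forall x, q (F x) = f x.
  by apply: free_lift => i; apply: sq.
have [h hh] := free_copair F r.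
have [k [p hp]] := coherent_ker_free h.
exists k, (lsubmx \o p) => x; split=> [fx|[c <-]] /=.
  have [y hy] : exists y, r y = F x by apply/hq; rewrite hF.
  have [c hc] : exists c, p c = row_mx x (- y).
    by apply/hp; rewrite hh row_mxKl row_mxKr linearN hy subrr.
  by exists c; rewrite hc row_mxKl.
rewrite -hF; apply/hq; exists (- rsubmx (p c)); rewrite linearN.
have /hp : exists d, p d = p c by exists c.
by rewrite hh => /eqP; rewrite addrC addr_eq0 => /eqP ->; rewrite opprK.
Qed.

End Coherent.

(** * The class Add of a module *)

Section Power.
Variables (R : pzRingType) (M : lmodType R).
Definition pow (k : nat) : lmodType R := {ffun 'I_k -> M}.

Lemma ffun_scale k (a : R) (v : pow k) i : (a *: v) i = a *: v i.
Proof. by rewrite ffunE. Qed.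
Lemma ffun_add k (u v : pow k) i : (u + v) i = u i + v i.
Proof. by rewrite ffunE. Qed.

Lemma pow_proj_linear k (i : 'I_k) : linear (fun v : pow k => v i).
Proof. by move=> a u v; rewrite ffun_add ffun_scale. Qed.
Definition pow_proj k i : {linear pow k -> M} := lin_of (@pow_proj_linear k i).

Lemma pow_tuple (U : lmodType R) k (f : 'I_k -> {linear U -> M}) :
  exists g : {linear U -> pow k}, forall x i, g x i = f i x.
Proof.
have lin : linear (fun x => [ffun i => f i x] : pow k).
  by move=> a x y; apply/ffunP => i; rewrite ffun_add ffun_scale !ffunE linearP.
by exists (lin_of lin) => x i; rewrite /= /lin_of ffunE.
Qed.

(** Apply the presentation of [M] to the [k] rows of a matrix. *)
Lemma pow_presentation b a (r : {linear 'rV[R]_b -> 'rV[R]_a})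
    (p : {linear 'rV[R]_a -> M}) k :
  surjective p -> (forall x, p x = 0 <-> exists y, r y = x) ->
  exists (r' : {linear 'rV[R]_(k * b) -> 'rV[R]_(k * a)})
         (p' : {linear 'rV[R]_(k * a) -> pow k}),
    surjective p' /\ forall x, p' x = 0 <-> exists y, r' y = x.
Proof.
move=> sp hp.
have lr : linear (fun y : 'rV[R]_(k * b) =>
    mxvec (\matrix_(i < k) r (row i (vec_mx y)))).
  move=> c x y; rewrite -linearP; congr mxvec; apply/matrixP => i j.
  by rewrite !mxE !linearP /= !mxE.
have lp (i : 'I_k) : linear (fun x : 'rV[R]_(k * a) => p (row i (vec_mx x))).
  by move=> c x y; rewrite !linearP.
have [p' hp'] := pow_tuple (fun i => lin_of (lp i)).
exists (lin_of lr), p'; split=> [v|x].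
  have [s hs] := choice (fun i => sp (v i)).
  exists (mxvec (\matrix_(i < k) s i)); apply/ffunP => i.
  by rewrite hp' /= /lin_of mxvecK rowK.
split=> [px|[y <-]].
  have h i : exists y, r y = row i (vec_mx x).
    by apply/hp; rewrite -[LHS]hp' px ffunE.
  have [s hs] := choice h; exists (mxvec (\matrix_(i < k) s i)).
  rewrite /= /lin_of -[RHS]vec_mxK; congr mxvec; apply/row_matrixP => i.
  by rewrite rowK mxvecK rowK hs.
apply/ffunP => i; rewrite hp' /= /lin_of mxvecK rowK ffunE.
by apply/hp; exists (row i (vec_mx y)).
Qed.

Lemma pow_fg k : finitely_generated M -> finitely_generated (pow k).
Proof.
move=> [a [p sp]].
have lp (i : 'I_k) : linear (fun x : 'rV[R]_(k * a) => p (row i (vec_mx x))).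
  by move=> c x y; rewrite !linearP.
have [p' hp'] := pow_tuple (fun i => lin_of (lp i)).
exists (k * a)%N, p' => v.
have [s hs] := choice (fun i => sp (v i)).
exists (mxvec (\matrix_(i < k) s i)); apply/ffunP => i.
by rewrite hp' /= /lin_of mxvecK rowK.
Qed.
End Power.

Section AddProps.
Variables (R : pzRingType) (M : lmodType R).

(** All later arguments use membership in [Add M] in the form of this retraction. *)
Lemma Add_retract (N : lmodType R) : Add M N ->
  exists (I : choiceType) (s : {linear N -> dsum (fun _ : I => M)})
    (r : {linear dsum (fun _ : I => M) -> N}), forall x, r (s x) = x.
Proof.
move=> [I [N' [phi [psi phiK psiK]]]].
have psil : linear psi.
  by move=> a x y; apply: (can_inj phiK); rewrite linearP !psiK.
have sl : linear (fun x => phi (x, 0)).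
  move=> a x y; rewrite -linearP; congr (phi _).
  by congr (_, _); rewrite /= scaler0 addr0.
have rl : linear (fun x => (psi x).1) by move=> a x y; rewrite psil.
by exists I, (lin_of sl), (lin_of rl) => x; rewrite /= /lin_of phiK.
Qed.

Lemma retract_Add (N : lmodType R) (I : choiceType)
    (s : {linear N -> dsum (fun _ : I => M)})
    (r : {linear dsum (fun _ : I => M) -> N}) : (forall x, r (s x) = x) -> Add M N.
Proof.
move=> rs; exists I, (sub_module (ker r)).
have fl : linear (fun x : N * sub_module (ker r) => s x.1 + sub_incl x.2).
  by move=> a x y; rewrite !linearP scalerDr addrACA.
exists (lin_of fl).
have kr x : ker r (x - s (r x)) by rewrite /ker /= linearB rs subrr.
pose gl x := (r x, Sub (x - s (r x)) (introT (in_subP (ker r) _) (kr x)) : sub_module (ker r)).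
exists gl => [[x y]|x]; rewrite /= /lin_of /gl /=; last by rewrite subrKC.
have ry : r (sub_incl y) = 0 := sub_inclP y.
congr (_, _); first by rewrite linearD rs ry addr0.
by apply: val_inj; rewrite /= linearD rs ry addr0 addrC addKr.
Qed.

(** The direct sum of the retractions; the free index set is the disjoint union
    [L] of the index sets [J i]. *)
Lemma Add_dsum (I : choiceType) (A : I -> lmodType R) :
  (forall i, Add M (A i)) -> Add M (dsum A).
Proof.
move=> hA.
have /dep_choice [J] i := Add_retract (hA i).
move=> /dep_choice [s] /dep_choice [r rs].
pose L : choiceType := {i : I & J i}.
pose iota i : {linear dsum (fun _ : J i => M) -> dsum (fun _ : L => M)} :=
  @dsum_copair R (J i) (fun=> M) (dsum (fun _ : L => M))
    (fun j => @dsum_incl R L (fun=> M) (existT J i j)).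
pose S : {linear dsum A -> dsum (fun _ : L => M)} :=
  @dsum_copair R I A (dsum (fun _ : L => M)) (fun i => iota i \o s i).
pose Rr : {linear dsum (fun _ : L => M) -> dsum A} :=
  @dsum_copair R L (fun=> M) (dsum A) (fun l : L =>
    @dsum_incl R I A (projT1 l) \o (r (projT1 l) \o @dsum_incl R _ (fun=> M) (projT2 l))).
apply: (@retract_Add _ L S Rr) => x.
apply: (@dsum_lin_ext _ _ _ _ (Rr \o S) idfun) => i a.
rewrite /= dsum_copair_in /=.
transitivity (@dsum_incl R I A i (r i (s i a))); last by rewrite rs.
move: (s i a); apply: (@dsum_lin_ext _ _ _ _ (Rr \o iota i) (@dsum_incl R I A i \o r i)) => j m.
by rewrite /= dsum_copair_in dsum_copair_in.
Qed.

Lemma Add_pow k : Add M (pow M k).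
Proof.
have rl : linear (fun x : dsum (fun _ : 'I_k => M) => [ffun l => x l] : pow M k).
  by move=> a x y; apply/ffunP => i; rewrite ffun_add ffun_scale !ffunE.
have [|s hs] := @dsum_pair _ 'I_k (fun=> M) _ (fun l => pow_proj M l).
  by move=> x; apply: (sub_finite_set _ (finite_seq (enum 'I_k))) => i _ /=; rewrite mem_enum.
apply: (@retract_Add _ _ s (lin_of rl)) => x; apply/ffunP => i.
by rewrite /= /lin_of ffunE hs.
Qed.

(** Lifting problems for cocycles ([d \o f = 0]) with source in [Add M] are solved
    on each copy of [M].  Taking [d = 0] gives lifting along surjections, taking
    [g] and [d] to be consecutive differentials gives exactness of [Hom (P, Y)]. *)
Lemma Add_lift (B C D : lmodType R) (g : {linear B -> C}) (d : {linear C -> D}) :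
  (forall f : {linear M -> C}, (forall x, d (f x) = 0) ->
    exists h : {linear M -> B}, forall x, g (h x) = f x) ->
  forall P, Add M P -> forall f : {linear P -> C}, (forall x, d (f x) = 0) ->
    exists h : {linear P -> B}, forall x, g (h x) = f x.
Proof.
move=> hM P /Add_retract [I [s [r rs]]] f df.
have /choice [h hh] i : exists h : {linear M -> B},
    forall x, g (h x) = f (r (@dsum_incl R I (fun=> M) i x)).
  by apply: (hM (f \o (r \o @dsum_incl R I (fun=> M) i))) => x /=.
pose H : {linear dsum (fun _ : I => M) -> B} := @dsum_copair R I (fun=> M) B h.
exists (H \o s) => x /=; rewrite -[in RHS](rs x).
move: (s x); apply: (@dsum_lin_ext _ _ _ _ (g \o H) (f \o r)) => i m.
by rewrite /= dsum_copair_in hh.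
Qed.
End AddProps.

(** Extension problems with target in [Add N] reduce to the direct sums of
    copies of [N], since every module of [Add N] is a retract of one. *)
Lemma Add_extend (R : pzRingType) (N G P : lmodType R) (e : {linear G -> P}) :
  (forall (I : choiceType) (f : {linear G -> dsum (fun _ : I => N)}),
     exists h : {linear P -> dsum (fun _ : I => N)}, forall x, h (e x) = f x) ->
  forall Y, Add N Y -> forall f : {linear G -> Y},
  exists h : {linear P -> Y}, forall x, h (e x) = f x.
Proof.
move=> he Y /Add_retract [I [s [r rs]]] f.
have [h hh] := he I (s \o f).
by exists (r \o h) => x; rewrite /= hh /= rs.
Qed.

(** * Preenvelopes of finitely presented modules *)

Lemma fp_fg (R : pzRingType) (M : lmodType R) :
  finitely_presented M -> finitely_generated M.
Proof. by move=> [m [n [r [p [sp _]]]]]; exists n, p. Qed.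

(** The relations of [C] are those of [P] together with lifts of the images under
    [e] of generators of [G]. *)
Lemma coker_fp (R : pzRingType) (G P C : lmodType R) (e : {linear G -> P})
    (q : {linear P -> C}) :
  finitely_generated G -> finitely_presented P -> surjective q ->
  (forall x, q x = 0 <-> exists y, e y = x) -> finitely_presented C.
Proof.
move=> [n [g sg]] [b [a [r [p [sp hp]]]]] sq hq.
have [F hF] : exists F : {linear 'rV[R]_n -> 'rV[R]_a}, forall x, p (F x) = e (g x).
  by apply: (free_lift (f := e \o g)) => i; apply: sp.
have [h hh] := free_copair r F.
exists (b + n)%N, a, h, (q \o p); split=> [c|x] /=.
  by have [y <-] := sq c; have [x <-] := sp y; exists x.
split=> [/hq [y hy]|[c <-]].
  have [z hz] := sg y.
  have /hp [t ht] : p (x - F z) = 0 by rewrite linearB hF hz hy subrr.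
  by exists (row_mx t z); rewrite hh row_mxKl row_mxKr ht subrK.
rewrite hh; apply/hq; exists (g (rsubmx c)); rewrite linearD hF.
suff -> : p (r (lsubmx c)) = 0 by rewrite add0r.
by apply/hp; exists (lsubmx c).
Qed.

Section Bimodule.
Variables (R : pzRingType) (coh : right_coherent R) (M : bimodule R).
Hypothesis fpr : finitely_presented (bim_right M).

Lemma right_mul_linear (a : R) : linear (fun x : bim_left M => bim_act x a).
Proof. by move=> c x y; rewrite bim_actDl bim_actZ. Qed.
Definition right_mul a : {linear bim_left M -> bim_left M} := lin_of (right_mul_linear a).

(** By a presentation of [G] with [n] generators, [Hom (G, M)] is the submodule of
    the right module [M ^ n] cut out by the maps [F k] belonging to the
    relations.  These maps are right linear because [M] is a bimodule, so
    coherence yields finitely many generators [g l], and a map [f] is the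
    combination of the [g l] with coefficients acting on the right. *)
Lemma hom_fg (G : lmodType R) : finitely_presented G ->
  exists k (g : 'I_k -> {linear G -> bim_left M}),
    forall f : {linear G -> bim_left M}, exists c : 'I_k -> R,
      forall x, f x = \sum_l right_mul (c l) (g l x).
Proof.
move=> [m [n [r [p [sp hp]]]]].
pose rel (k : 'I_m) := r (delta_mx 0 k).
have Flin (k : 'I_m) : linear (fun v : pow (bim_right M) n =>
    (\sum_i (rel k 0 i : R) *: (v i : bim_left M)) : bim_right M).
  move=> a u v; rewrite scaler_sumr -big_split; apply: eq_bigr => i _ /=.
  rewrite ffun_add ffun_scale /= scalerDr; congr (_ + _).
  exact/esym/bim_actZ.
have [K [q hq]] : fg_pred (fun v => True /\ forall k, k \in enum 'I_m -> lin_of (Flin k) v = 0).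
  apply: fg_ker_bigcap => [N g|]; first exact: (coherent_ker_fp coh).
  have [N [q sq]] := pow_fg n (fp_fg fpr).
  by exists N, q => x; split=> // _; apply: sq.
pose v l : 'I_n -> bim_left M := q (delta_mx 0 l).
have hv l : exists g : {linear G -> bim_left M}, forall x, g (p x) = lincomb (v l) x.
  apply: factor_surj => // x /hp [y <-].
  have /hq [_ hl] : exists c, q c = q (delta_mx 0 l) by exists (delta_mx 0 l).
  rewrite [y]row_sum_delta !linear_sum big1 // => k _.
  by rewrite !linearZ /= [lincomb _ _](hl k) ?mem_enum // scaler0.
have [g hg] := choice hv.
exists K, g => f.
pose w : pow (bim_right M) n := [ffun i => f (p (delta_mx 0 i))].
have [c hc] : exists c, q c = w.
  apply/hq; split=> // k _; rewrite /= /lin_of.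
  transitivity (f (p (rel k))).
    rewrite [X in f (p X)]row_sum_delta !linear_sum; apply: eq_bigr => i _.
    by rewrite !linearZ /= /w ffunE.
  suff -> : p (rel k) = 0 by rewrite linear0.
  by apply/hp; exists (delta_mx 0 k).
exists (fun l => c 0 l) => z; have [x <-] := sp z.
rewrite (eq_bigr (fun l => \sum_i x 0 i *: right_mul (c 0 l) (v l i))); last first.
  by move=> l _; rewrite hg /lincomb linear_sum; apply: eq_bigr => i _; rewrite linearZ.
rewrite exchange_big /= [X in f (p X)]row_sum_delta !linear_sum; apply: eq_bigr => i _.
rewrite !linearZ -scaler_sumr /=; congr (_ *: _).
transitivity (w i : bim_left M); first by rewrite /w ffunE.
rewrite -hc (lincombE q) /lincomb sum_ffunE.
by apply: eq_bigr => l _; rewrite ffunE.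
Qed.

Lemma right_mul0 x : right_mul 0 x = 0.
Proof. exact: (@scale0r _ (bim_right M) x). Qed.

End Bimodule.

Section Preenvelope.
Variables (R : pzRingType) (coh : right_coherent R) (M : bimodule R).
Hypotheses (fpl : finitely_presented (bim_left M))
           (fpr : finitely_presented (bim_right M)).

(** The components of [e] generate [Hom (G, M)].  A map from [G] to a direct sum of
    copies of [M] has only finitely many nonzero components; each is a right
    combination of the components of [e], the zero ones with zero coefficients,
    and so extends along [e]. *)
Lemma add_preenvelope (G : lmodType R) : finitely_presented G ->
  exists k (e : {linear G -> pow (bim_left M) k}),
    forall Y, Add (bim_left M) Y -> forall f : {linear G -> Y},
    exists h : {linear pow (bim_left M) k -> Y}, forall x, h (e x) = f x.
Proof.
move=> fpG; have [k [g hg]] := hom_fg coh fpr fpG.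
have [e he] := pow_tuple g.
exists k, e => Y; apply: Add_extend => I f.
have [s [_ hs]] := fg_dsum_supp f (fp_fg fpG).
have /choice [c hc] i : exists c : 'I_k -> R,
    (i \notin s -> c = fun=> 0) /\ forall x, f x i = \sum_l right_mul M (c l) (g l x).
  have [si|si] := boolP (i \in s).
    by have [c hc] := hg (dsum_proj i \o f); exists c.
  exists (fun=> 0); split=> // x; rewrite big1 => [|l _]; last exact: right_mul0.
  by apply/eqP; apply: contraNT si; apply: hs.
have hl i : linear (fun w : pow (bim_left M) k => \sum_l right_mul M (c i l) (w l)).
  move=> a u v; rewrite scaler_sumr -big_split; apply: eq_bigr => l _ /=.
  by rewrite ffun_add ffun_scale linearP.
have [|h hh] := @dsum_pair _ I (fun=> bim_left M) _ (fun i => lin_of (hl i)).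
  move=> w; apply: (sub_finite_set _ (finite_seq s)) => i /=.
  apply: contraR => si; rewrite /lin_of (hc i).1 // big1 // => l _; exact: right_mul0.
exists h => x; apply: dsum_ext => i.
rewrite hh (hc i).2 /= /lin_of; apply: eq_bigr => l _; by rewrite he.
Qed.

Lemma pow_fp k : finitely_presented (pow (bim_left M) k).
Proof.
have [b [a [r [p [sp hp]]]]] := fpl.
have [r' [p' h]] := pow_presentation k sp hp.
by exists (k * b)%N, (k * a)%N, r', p'.
Qed.

End Preenvelope.

(** * Families indexed by the integers *)

(** Differentials are indexed so that [i + 1] is the generic degree; this and the
    next lemma give access to the degree [i] itself. *)
Lemma int_predE (P : int -> Prop) : (forall i, P (i + 1)) -> forall i, P i.
Proof. by move=> h i; rewrite -(subrK 1 i). Qed.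

Lemma pred_family (T : int -> Type) (f : forall i, T (i + 1)) :
  exists g : forall i, T i, forall i, g (i + 1) = f i.
Proof.
exists (fun i => eq_rect _ T (f (i - 1)) i (subrK 1 i)) => i.
move: (subrK 1 (i + 1)) (addrK 1 i); move: (i + 1 - 1) => j e ji; subst j.
by rewrite (eq_irrelevance e erefl).
Qed.

(** Dependent choice in descending degrees below [s].  The family is obtained by
    iterating, as often as the distance to [s], the operator that replaces the
    value in each degree [i < s] by a choice depending on the value in degree
    [i + 1]; working with whole families avoids transport between degrees. *)
Lemma down_rec (T : int -> Type) (P : forall i, T i -> Prop)
    (Q : forall i, T (i + 1) -> T i -> Prop) (t0 : forall i, T i) (s : int) :
  P s (t0 s) ->
  (forall i, i < s -> forall b, P (i + 1) b -> exists a, P i a /\ Q i b a) ->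
  exists t : forall i, T i,
    (forall i, s <= i -> t i = t0 i) /\
    (forall i, i < s -> P i (t i) /\ Q i (t (i + 1)) (t i)).
Proof.
move=> Ps step.
have /dep_choice [phi hphi] i : exists phi : T (i + 1) -> T i,
    i < s -> forall b, P (i + 1) b -> P i (phi b) /\ Q i b (phi b).
  have [si|si] := boolP (i < s); last by exists (fun=> t0 i).
  have /choice [phi h] b : exists a, P (i + 1) b -> P i a /\ Q i b a.
    have [/(step _ si) [a ha]|nb] := pselect (P (i + 1) b); first by exists a.
    by exists (t0 i).
  by exists phi => _ b /h.
(* degrees from [s] on are frozen, so the value in degree [i] is stable after
   [s - i] iterations *)
pose F (t : forall i, T i) i := if s <= i then t0 i else phi i (t (i + 1)).
pose t i := iter `|s - i|%N F t0 i.
have t_ge i : s <= i -> t i = t0 i.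
  by rewrite /t; case: `|s - i|%N => //= n si; rewrite /F si.
have t_lt i : i < s -> t i = phi i (t (i + 1)).
  move=> si; rewrite /t.
  have -> : `|s - i|%N = `|s - (i + 1)%R|%N.+1 by lia.
  by rewrite iterS {1}/F leNgt si.
have Pt n i : i <= s -> `|s - i|%N = n -> P i (t i).
  elim: n i => [|n IH] i si hn.
    have -> : i = s by lia.
    by rewrite t_ge.
  have is_ : i < s by lia.
  by rewrite t_lt //; apply: (hphi i is_ _ _).1; apply: IH; lia.
exists t; split=> // i si; split; first by apply: (Pt _ _ _ erefl); lia.
by rewrite [t i]t_lt //; apply: (hphi i si _ _).2; apply: (Pt _ _ _ erefl); lia.
Qed.

(** * Towers of preenvelopes *)

(** The differential leaving degree [i]: as its target is [Y (i - 1)] only up to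
    transport, the target is made part of the data. *)
Lemma prev_d (R : pzRingType) (Y : complex R) :
  exists D : forall i, {V : lmodType R & {linear Y i -> V}},
    (forall i y, projT2 (D (i + 1)) y = 0 <-> cx_d Y i y = 0) /\
    (forall i y, projT2 (D i) (cx_d Y i y) = 0).
Proof.
have [D hD] := pred_family (T := fun i => {V : lmodType R & {linear Y i -> V}})
  (fun i => existT _ (Y i) (cx_d Y i)).
exists D; split=> [i y|]; first by rewrite hD.
by apply: int_predE => i y; rewrite hD /= cx_dd.
Qed.

Section Tower.
Variables (R : pzRingType) (M : lmodType R).
Variables (g : int -> lmodType R) (k : int -> nat).
Variables (e : forall i, {linear g (i + 1) -> pow M (k i)})
          (p : forall i, {linear pow M (k i) -> g i}) (s : int).
Arguments p i : clear implicits.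

(** In each degree below [s], [e i] is an [Add M]-preenvelope of [g (i + 1)] and
    [p i] its cokernel; from [s] on the complex vanishes.  Thus [g s] is the module
    to which the tower is attached, and the top degree of the complex is [s - 1]. *)
Definition is_tower := [/\ forall i x, p i (e i x) = 0,
  forall i, i < s -> forall Y, Add M Y -> forall f : {linear g (i + 1) -> Y},
    exists h : {linear pow M (k i) -> Y}, forall x, h (e i x) = f x,
  forall i, i < s -> surjective (p i),
  forall i, i < s -> forall x, p i x = 0 -> exists y, e i y = x &
  forall i, s <= i -> k i = 0%N].

Hypothesis tower : is_tower.

Lemma tower_dd i x : (e i \o p (i + 1)) ((e (i + 1) \o p (i + 1 + 1)) x) = 0.
Proof. by case: tower => pe _ _ _ _; rewrite /= pe linear0. Qed.

Definition tower_cx : complex R := Complex tower_dd.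

Lemma tower_top i (x : tower_cx i) : s <= i -> x = 0.
Proof.
case: tower => _ _ _ _ k0 si; apply/ffunP => j.
by have := ltn_ord j; rewrite [X in (_ < X)%N -> _]k0.
Qed.

Section Maps.
Variables (Y : complex R) (hY : forall i, Add M (Y i)).

(** The universal property of the cokernel [p] of [e], followed by that of the
    preenvelope [e] in the next degree. *)
Lemma tower_step i (N : lmodType R) (f : {linear tower_cx (i + 1) -> N}) :
  Add M N -> i + 1 < s -> (forall x, f (e (i + 1) x) = 0) ->
  exists h : {linear tower_cx i -> N}, forall x, h (cx_d tower_cx i x) = f x.
Proof.
case: tower => pe pre sp cok _ hN si fe.
have [|h hh] := factor_surj (f := f) (sp _ si).
  by move=> x /(cok _ si) [y <-].
have [|h' hh'] := pre i _ N hN h; first by lia.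
by exists h' => x; rewrite /= hh' hh.
Qed.

(** The homotopy is built downwards, starting with zero in the top degree [t].  The
    condition carried along says that the error [F - d sg] vanishes on the image of
    [e] in degree [i]; it makes the next application of [tower_step] possible. *)
Lemma tower_null t (F : chain_map tower_cx Y) : t + 1 = s ->
  (forall x, F t (e t x) = 0) -> null_homotopic F.
Proof.
move=> ts Fe; have [_ _ sp _ _] := tower.
have [|i si b Pb|sg [_ hsg]] := @down_rec (fun i => {linear tower_cx i -> Y (i + 1)})
  (fun i a => forall x, F i (e i x) = cx_d Y i (a (e i x)))
  (fun i b a => forall x, F (i + 1) x = cx_d Y (i + 1) (b x) + a (cx_d tower_cx i x))
  (fun i => \0) t.
- by move=> x; rewrite Fe linear0.
- have [||a ha] := @tower_step i _ (F (i + 1) \- (cx_d Y (i + 1) \o b)) (hY _).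
    + by lia.
    + by move=> x; rewrite /= Pb subrr.
  exists a; split=> x; last by rewrite ha /= [RHS]addrC subrK.
  have [|z <-] := sp (i + 1) _ x; first by lia.
  have := ha z; rewrite /= => ->.
  by rewrite linearB /= cx_dd subr0 [LHS](@cm_comm _ _ _ F i z).
exists sg => i x.
have [it|it] := ltP i t; first by have [_ ->] := hsg i it.
by rewrite [x]tower_top ?linear0 ?addr0 //; lia.
Qed.

(** Extend [f] along the first preenvelope and continue downwards; the condition
    carried along says that the map sends the image of [e i] to cycles. *)
Lemma tower_extend u (f : {linear g (u + 1 + 1) -> Y (u + 1)}) : u + 1 + 1 = s ->
  (forall x, cx_d Y u (f x) = 0) ->
  exists F : chain_map tower_cx Y, forall x, F (u + 1) (e (u + 1) x) = f x.
Proof.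
move=> us fc; have [_ pre sp _ _] := tower.
have [D [D1 Dd]] := prev_d Y.
have [|F0 hF0] := pre (u + 1) _ _ (hY _) f; first by lia.
pose t0 := dfwith (T := fun i => {linear tower_cx i -> Y i}) (fun i => \0) F0.
have [|i si b Pb|F [F1 F2]] := @down_rec (fun i => {linear tower_cx i -> Y i})
  (fun i a => forall x, projT2 (D i) (a (e i x)) = 0)
  (fun i b a => forall x, a (cx_d tower_cx i x) = cx_d Y i (b x)) t0 (u + 1).
- by move=> x; apply/D1; rewrite /t0 dfwith_in hF0.
- have [||a ha] := @tower_step i _ (cx_d Y i \o b : {linear tower_cx (i + 1) -> Y i}) (hY i).
    + by lia.
    + by move=> x; rewrite /=; apply/D1.
  exists a; split=> // x.
  have [|z <-] := sp (i + 1) _ x; first by lia.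
  by have := ha z; rewrite /= => ->; exact: Dd.
have Fc i x : F i (cx_d tower_cx i x) = cx_d Y i (F (i + 1) x).
  have [it|it] := ltP i (u + 1); first by have [_ ->] := F2 i it.
  by rewrite [x]tower_top ?linear0 //; lia.
by exists (ChainMap Fc) => x; rewrite /= F1 // /t0 dfwith_in hF0.
Qed.
End Maps.
End Tower.

(** Alternate preenvelopes and cokernels, which stay finitely presented because the
    powers of [M] are. *)
Lemma tower_exists (R : pzRingType) (coh : right_coherent R) (M : bimodule R) :
  finitely_presented (bim_left M) -> finitely_presented (bim_right M) ->
  forall (G : lmodType R) (s : int), finitely_presented G ->
  exists g k e p, g s = G /\ finitely_presented (g s) /\ @is_tower R (bim_left M) g k e p s.
Proof.
move=> fpl fpr G s fpG.
pose N k := pow (bim_left M) k.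
pose good (b a : lmodType R) k (e : {linear b -> N k}) (p : {linear N k -> a}) :=
  [/\ forall x, p (e x) = 0,
  forall Y, Add (bim_left M) Y -> forall f : {linear b -> Y},
    exists h : {linear N k -> Y}, forall x, h (e x) = f x,
  surjective p &
  forall x, p x = 0 -> exists y, e y = x].
have [//|i si b fpb|g [g1 g2]] := @down_rec (fun=> lmodType R)
  (fun i a => finitely_presented a)
  (fun i b a => exists k e p, @good b a k e p) (fun=> G) s.
  have [k [e he]] := add_preenvelope coh fpr fpb.
  exists (quot_module (im e)); split.
    apply: (coker_fp (e := e) (q := @quot_proj _ _ (im e))) => //.
    - exact: fp_fg.
    - exact: pow_fp.
    - exact: quot_proj_surj.
    - by move=> x; rewrite quot_proj_eq0.
  exists k, e, (@quot_proj _ _ (im e)); split=> //.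
  - by move=> x; apply/quot_proj_eq0; exists x.
  - exact: quot_proj_surj.
  - by move=> x /quot_proj_eq0.
have /dep_choice [r hr] (i : int) : exists r :
    {k : nat & ({linear g (i + 1)%R -> N k} * {linear N k -> g i})%type},
    [/\ forall x, (projT2 r).2 ((projT2 r).1 x) = 0,
      i < s -> good _ _ _ (projT2 r).1 (projT2 r).2 & s <= i -> projT1 r = 0%N].
  have [si|si] := ltP i s.
    have [_ [k [e [p h]]]] := g2 i si; exists (existT _ k (e, p)); split=> //=.
    by case: h.
  pose z1 : {linear g (i + 1) -> N 0%N} := \0; pose z2 : {linear N 0%N -> g i} := \0.
  by exists (existT _ 0%N (z1, z2)).
exists g, (fun i => projT1 (r i)), (fun i => (projT2 (r i)).1), (fun i => (projT2 (r i)).2).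
have gs : g s = G by apply: g1.
split=> //; split; first by rewrite gs.
by split=> [i|i|i|i|i]; have [h1 h2 h3] := hr i => // /h2 [].
Qed.

(** * Coproducts and compact objects *)

Section Preadditive.
Variable T : preadditive.

Lemma comp0r (X Y Z : T) (g : hom Y Z) : comp g (0 : hom X Y) = 0.
Proof. by apply: (addrI (comp g 0)); rewrite -compDr !addr0. Qed.

Lemma comp0l (X Y Z : T) (f : hom X Y) : comp (0 : hom Y Z) f = 0.
Proof. by apply: (addrI (comp 0 f)); rewrite -compDl !addr0. Qed.

Lemma comp_sumr (X Y Z : T) (g : hom Y Z) (I : Type) (r : seq I) (F : I -> hom X Y) :
  comp g (\sum_(i <- r) F i) = \sum_(i <- r) comp g (F i).
Proof.
apply: (big_morph (fun f : hom X Y => comp g f)) => [f f'|].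
  exact: compDr.
exact: comp0r.
Qed.

Lemma zero_of_id (X : T) : idm X = 0 -> zero_object X.
Proof.
move=> h Y; split=> f g.
  by rewrite -[f]compm1 -[g]compm1 h !comp0r.
by rewrite -[f]comp1m -[g]comp1m h !comp0l.
Qed.

(** By the universal property, applied to the identity and zero maps. *)
Lemma coproduct_proj (I : choiceType) (X : I -> T) (S : T) (j : forall i, hom (X i) S) i :
  is_coproduct j ->
  exists q : hom S (X i), comp q (j i) = idm (X i) /\
    forall k, i != k -> comp q (j k) = 0.
Proof.
move=> cj.
have [q [hq _]] := cj (X i) (dfwith (T := fun k => hom (X k) (X i)) (fun=> 0) (idm (X i))).
exists q; split; first by rewrite hq dfwith_in.
by move=> k ik; rewrite hq dfwith_out.
Qed.

(** Surjectivity may be tested on one coproduct of each family, as coproducts are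
    unique up to isomorphism; injectivity follows from the projections. *)
Lemma compact_criterion (C : T) :
  (forall (I : choiceType) (X : I -> T), exists (S : T) (j : forall i, hom (X i) S),
    is_coproduct j /\
    forall f : hom C S, exists (s : seq I) (g : forall i, hom C (X i)),
      uniq s /\ f = \sum_(i <- s) comp (j i) (g i)) ->
  compact C.
Proof.
move=> h I X S j cj.
pose ev (f : dsum (fun i => hom C (X i))) := \sum_(i \in [set: I]) comp (j i) (f i).
have evE (f : dsum (fun i => hom C (X i))) (s : seq I) : uniq s ->
    (forall i, i \notin s -> f i = 0) -> ev f = \sum_(i <- s) comp (j i) (f i).
  move=> us hs; rewrite /ev (fsbigE s) //.
    by apply: eq_bigl => i; rewrite in_setT.
  by move=> i _ /hs ->; rewrite comp0r.
have evS (f : dsum (fun i => hom C (X i))) : exists2 s, uniq s & forall i, i \notin s -> f i = 0.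
  exists (finmap.enum_fset (fset_set [set i | f i != 0])); first exact: finmap.fset_uniq.
  move=> i hi; apply/eqP; apply: contraNT hi => hi.
  have := in_fset_set (dsum_fin f) i.
  by rewrite /= => ->; rewrite inE.
suff /choice [inv hinv] : forall f, exists x, ev x = f.
  exists inv => // f.
  have injev (f1 f2 : dsum (fun i => hom C (X i))) : ev f1 = ev f2 -> f1 = f2.
    move=> ef; apply: dsum_ext => i.
    have [q [qi qk]] := coproduct_proj i cj.
    have evi (f0 : dsum (fun i => hom C (X i))) : comp q (ev f0) = f0 i.
      have [s us hs] := evS f0; rewrite (evE _ _ us hs) comp_sumr.
      have [si|si] := boolP (i \in s).
        rewrite (bigD1_seq i) //= compA qi comp1m big1 ?addr0 // => k ki.
        by rewrite compA qk 1?eq_sym // comp0l.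
      rewrite hs // big_seq big1 // => k ks.
      rewrite compA qk ?comp0l //.
      by apply: contraNneq si => ->.
    by rewrite -!evi ef.
  by apply: injev; apply: hinv.
move=> f; have [S0 [j0 [cj0 h0]]] := h I X.
have [u [hu _]] := cj0 S j.
have [v [hv _]] := cj S0 j0.
have uv : comp u v = idm S.
  have [w [_ hw]] := cj S j.
  rewrite -(hw (comp u v)); last by move=> i; rewrite -compA hv hu.
  by apply: hw => i; rewrite comp1m.
have [s [g [us hs]]] := h0 (comp v f).
have fin : finite_set [set i | (if i \in s then g i else 0) != 0].
  apply: (sub_finite_set _ (finite_seq s)) => i /=.
  by case: ifP => //; rewrite eqxx.
pose G : dsum (fun i => hom C (X i)) := DSum fin.
exists G; rewrite (evE G s us); last by move=> i /negPf /= ->.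
rewrite -[f]comp1m -uv -compA hs comp_sumr.
by apply: eq_big_seq => i si; rewrite /= si compA hu.
Qed.
End Preadditive.

Section CoproductComplex.
Variables (R : pzRingType) (I : choiceType) (Y : I -> complex R).

Lemma csum_dd i x : dsum_map (fun a => cx_d (Y a) i) (dsum_map (fun a => cx_d (Y a) (i + 1)) x) = 0.
Proof. by apply: dsum_ext => a /=; rewrite cx_dd. Qed.

Definition csum : complex R :=
  @Complex R (fun i => dsum (fun a => Y a i)) (fun i => dsum_map (fun a => cx_d (Y a) i)) csum_dd.

Lemma csum_in_comm a i x :
  dsum_incl (fun a => Y a i) a (cx_d (Y a) i x) =
  cx_d csum i (dsum_incl (fun a => Y a (i + 1)) a x).
Proof. by rewrite /= dsum_map_in. Qed.
Definition csum_in a : chain_map (Y a) csum :=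
  @ChainMap R (Y a) csum (fun i => dsum_incl (fun a => Y a i) a) (@csum_in_comm a).

Lemma csum_pr_comm a i x :
  dsum_proj (A := fun a => Y a i) a (cx_d csum i x) =
  cx_d (Y a) i (dsum_proj (A := fun a => Y a (i + 1)) a x).
Proof. by []. Qed.
Definition csum_pr a : chain_map csum (Y a) :=
  @ChainMap R csum (Y a) (fun i => dsum_proj (A := fun a => Y a i) a) (@csum_pr_comm a).

Section Copair.
Variables (Z : complex R) (f : forall a, chain_map (Y a) Z).

Lemma csum_copair_comm i (x : csum (i + 1)) :
  dsum_copair (fun a => f a i) (cx_d csum i x) = cx_d Z i (dsum_copair (fun a => f a (i + 1)) x).
Proof.
move: x; apply: (@dsum_lin_ext _ _ _ _ (dsum_copair (fun a => f a i) \o cx_d csum i)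
  (cx_d Z i \o dsum_copair (fun a => f a (i + 1)))) => a y.
by rewrite /= dsum_map_in !dsum_copair_in cm_comm.
Qed.
Definition csum_copair : chain_map csum Z :=
  @ChainMap R csum Z (fun i => dsum_copair (fun a => f a i)) csum_copair_comm.

Lemma csum_copair_in a : cm_comp csum_copair (csum_in a) = f a.
Proof. by apply: cm_ext => i x; rewrite /= dsum_copair_in. Qed.
End Copair.

(** Null homotopies on the summands assemble to one on the sum.  This is what makes the
    degreewise direct sum a coproduct up to homotopy. *)
Lemma csum_null (Z : complex R) (f : chain_map csum Z) :
  (forall a, null_homotopic (cm_comp f (csum_in a))) -> null_homotopic f.
Proof.
move=> /dep_choice [s hs].
exists (fun i => dsum_copair (fun a => s a i)) => i.
apply: (@dsum_lin_ext _ _ _ _ (f (i + 1)) ((cx_d Z (i + 1) \o dsum_copair (fun a => s a (i + 1)))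
  \+ (dsum_copair (fun a => s a i) \o cx_d csum i))) => a x.
by rewrite /= dsum_map_in !dsum_copair_in -hs.
Qed.
End CoproductComplex.

Section KAdd.
Variables (R : pzRingType) (X : lmodType R -> Prop).
Hypothesis X_dsum : forall (I : choiceType) (A : I -> lmodType R),
  (forall i, X (A i)) -> X (dsum A).

Definition K_ob (Y : complex R) (hY : forall i, X (Y i)) : K X := exist _ Y hY.

Lemma csum_X (I : choiceType) (Y : I -> K X) i : X (csum (fun a => sval (Y a)) i).
Proof. by apply: X_dsum => a; apply: (svalP (Y a)). Qed.

Definition K_sum (I : choiceType) (Y : I -> K X) : K X := K_ob (csum_X Y).
Definition K_sum_in (I : choiceType) (Y : I -> K X) a : hom (Y a) (K_sum Y) :=
  cls (csum_in (fun a => sval (Y a)) a).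

Lemma K_sum_coproduct (I : choiceType) (Y : I -> K X) : is_coproduct (K_sum_in Y).
Proof.
move=> Z g.
pose H := csum_copair (fun a => repr (g a : homK (sval (Y a)) (sval Z))).
exists (cls H); split=> [a|h'].
  by rewrite /= compK_cls csum_copair_in clsK.
rewrite -[h']clsK; move: (repr _) => r hr; apply/esym/cls_eq/csum_null => a.
have := hr a; rewrite -[RHS]clsK /= compK_cls => /cls_eq nh.
by congr (null_homotopic _): nh; apply: cm_ext => i x; rewrite /= dsum_copair_in.
Qed.

Lemma K_has_coproducts : has_coproducts (K X).
Proof. by move=> I Y; exists (K_sum Y), (K_sum_in Y); apply: K_sum_coproduct. Qed.

End KAdd.

Section Classes.
Variable R : pzRingType.

Lemma cls0 (C D : complex R) (f : chain_map C D) : cls f = 0 <-> null_homotopic f.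
Proof.
have c0 : cls (0 : chain_map C D) = 0 by rewrite /cls raddf0.
by rewrite -c0 cls_eq subr0.
Qed.

Lemma cls_sum (C D : complex R) (J : Type) (r : seq J) (F : J -> chain_map C D) :
  cls (\sum_(j <- r) F j) = \sum_(j <- r) cls (F j).
Proof. by rewrite /cls raddf_sum. Qed.

Lemma cm_sum (C D : complex R) (J : Type) (r : seq J) (F : J -> chain_map C D) i x :
  (\sum_(j <- r) F j) i x = \sum_(j <- r) F j i x.
Proof. by elim/big_rec2: _ => //= j y z _ <-. Qed.
End Classes.

Section Towers.
Variables (R : pzRingType) (M : lmodType R).
Variables (g : int -> lmodType R) (k : int -> nat)
  (e : forall i, {linear g (i + 1) -> pow M (k i)})
  (p : forall i, {linear pow M (k i) -> g i}) (s : int).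
Hypothesis tower : is_tower e p s.

(** The restriction of a chain map [F] to [g s] in the top degree [t] has
    components in a finite set [r] of summands only.  Then [F] and the sum of its
    components in [r] agree on [g s], so they are homotopic by [tower_null]. *)
Lemma tower_compact (hC : forall i, Add M (tower_cx tower i)) :
  finitely_generated (g s) -> compact (K_ob hC).
Proof.
move=> fgG; apply: compact_criterion => I Y.
exists (K_sum (@Add_dsum _ M) Y), (K_sum_in (@Add_dsum _ M) Y).
split; first exact: K_sum_coproduct.
pose C := tower_cx tower; pose S := csum (fun a => sval (Y a)).
move=> f; pose F : chain_map C S := repr (f : homK C S).
have [t ts] : exists t, t + 1 = s by exists (s - 1); rewrite subrK.
have fgG1 : finitely_generated (g (t + 1)) by rewrite ts.
have [r [ur hr]] := fg_dsum_supp (A := fun a => sval (Y a) t) (F t \o e t) fgG1.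
exists r, (fun a => cls (cm_comp (csum_pr (fun a => sval (Y a)) a) F)); split=> //.
rewrite -[LHS]clsK -/F.
under eq_bigr => a _ do rewrite /= compK_cls.
rewrite -cls_sum; apply/cls_eq.
apply: (@tower_null _ _ _ _ _ _ _ tower _ (svalP (K_sum (@Add_dsum _ M) Y)) t _ ts) => x.
rewrite /= cm_sum; apply/eqP; rewrite subr_eq0; apply/eqP.
rewrite [LHS](@dsum_decomp _ _ _ _ r) // => a; exact: hr.
Qed.

(** Extend [f] to a chain map; a null homotopy of it, restricted to the top of the
    tower, is a lift of [f] along the differential. *)
Lemma tower_detects (Y : complex R) (hY : forall i, Add M (Y i)) u :
  u + 1 + 1 = s -> (forall F : chain_map (tower_cx tower) Y, null_homotopic F) ->
  forall f : {linear g (u + 1 + 1) -> Y (u + 1)}, (forall x, cx_d Y u (f x) = 0) ->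
  exists h : {linear g (u + 1 + 1) -> Y (u + 1 + 1)},
    forall x, cx_d Y (u + 1) (h x) = f x.
Proof.
move=> us hnull f fc.
have [F hF] := tower_extend tower hY us fc.
have [sg hsg] := hnull F.
exists (sg (u + 1) \o e (u + 1)) => x; rewrite /= -hF hsg /=.
by case: tower => pe _ _ _ _; rewrite pe !linear0 addr0.
Qed.
End Towers.

(** Complexes of finite powers of [M] are small data, so that the compact ones
    among them can index a generating family. *)
Section Generators.
Variables (R : pzRingType) (M : lmodType R).

Record pow_complex := PowComplex {
  pc_exp : int -> nat;
  pc_d : forall i, {linear pow M (pc_exp (i + 1)) -> pow M (pc_exp i)};
  pc_dd : forall i x, pc_d i (pc_d (i + 1) x) = 0 }.

HB.instance Definition _ := gen_eqMixin pow_complex.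
HB.instance Definition _ := gen_choiceMixin pow_complex.

Definition pc_ob (c : pow_complex) : K (Add M) :=
  @K_ob _ (Add M) (Complex (@pc_dd c)) (fun i => Add_pow M (pc_exp c i)).

Definition pc_compact : {pred pow_complex} := fun c => `[< compact (pc_ob c) >].
End Generators.

Theorem K_Add_compactly_generated (R : pzRingType) (coh : right_coherent R) (M : bimodule R) :
  finitely_presented (bim_left M) -> finitely_presented (bim_right M) ->
  (forall Y : complex R, (forall i, Add (bim_left M) (Y i)) -> pure_exact Y ->
     null_homotopic (cm_id Y)) ->
  compactly_generated (K (Add (bim_left M))).
Proof.
move=> fpl fpr contr; split; first exact: K_has_coproducts (@Add_dsum _ _).
exists {c : pow_complex (bim_left M) | c \in @pc_compact R (bim_left M)}, (fun c => pc_ob (val c)).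
split=> [[c hc]|[Y hY] h]; first exact/asboolP.
suff pY : pure_exact Y by apply: zero_of_id; apply/cls0/contr.
move=> N fpN u f fc.
have [g [k [e [p [gs [fgs tower]]]]]] := tower_exists coh fpl fpr (u + 1 + 1) fpN.
subst N; apply: (tower_detects (tower := tower) hY erefl _ fc) => F.
pose c := @PowComplex R (bim_left M) k _ (tower_dd tower).
have hc : c \in @pc_compact R (bim_left M).
  by apply/asboolP; apply: (tower_compact (tower := tower)); apply: fp_fg.
by apply/cls0; apply: (h (exist _ c hc)).
Qed.

(** * Relative dimension and contractible complexes *)

Section Cycles.
Variables (R : pzRingType) (Y : complex R).

Definition cycles i : lmodType R := sub_module (ker (cx_d Y i)).
Definition cyc_in i : {linear cycles i -> Y (i + 1)} := sub_incl (S := ker (cx_d Y i)).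
Definition cyc_bd i : {linear Y (i + 1 + 1) -> cycles i} :=
  sub_corestr (S := ker (cx_d Y i)) (f := cx_d Y (i + 1)) (@cx_dd _ Y i).

Lemma cyc_inP i (z : cycles i) : cx_d Y i (cyc_in i z) = 0.
Proof. exact: (sub_inclP (S := ker (cx_d Y i)) z). Qed.
Lemma cyc_in_inj i : injective (cyc_in i).
Proof. exact: sub_incl_inj. Qed.
Lemma cyc_bdE i y : cyc_in i (cyc_bd i y) = cx_d Y (i + 1) y.
Proof. by []. Qed.

Lemma cyc_bd0 i y : cyc_bd i y = 0 <-> cx_d Y (i + 1) y = 0.
Proof.
split=> [h|h]; first by rewrite -cyc_bdE h linear0.
by apply: cyc_in_inj; rewrite cyc_bdE h linear0.
Qed.

Lemma cyc_factor i (V : lmodType R) (f : {linear V -> Y (i + 1)}) :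
  (forall x, cx_d Y i (f x) = 0) ->
  exists h : {linear V -> cycles i}, forall x, cyc_in i (h x) = f x.
Proof. by move=> hf; exists (sub_corestr (S := ker (cx_d Y i)) hf). Qed.
End Cycles.

Section Relative.
Variables (R : pzRingType) (N : lmodType R -> Prop).

(** Notions relative to a class [N] of test modules: ordinary and pure homological
    algebra arise from the projective and the pure projective modules. *)
Definition rel_epi (B C : lmodType R) (g : {linear B -> C}) :=
  forall P, N P -> forall f : {linear P -> C},
    exists h : {linear P -> B}, forall x, g (h x) = f x.

Definition rel_proj (P : lmodType R) :=
  forall (B C : lmodType R) (g : {linear B -> C}), rel_epi g ->
  forall f : {linear P -> C}, exists h : {linear P -> B}, forall x, g (h x) = f x.

Definition rel_exact (Y : complex R) := forall P, N P -> hom_exact P Y.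

Fixpoint rel_dim (n : nat) (A : lmodType R) : Prop :=
  if n is m.+1 then
    exists (P K : lmodType R) (g : {linear P -> A}) (u : {linear K -> P}),
      [/\ rel_proj P, rel_epi g, injective u,
          forall x, g x = 0 <-> exists y, u y = x & rel_dim m K]
  else rel_proj A.

Lemma rel_projN P : N P -> rel_proj P.
Proof. by move=> hP B C g; apply. Qed.

Lemma rel_proj0 P : zero_module P -> rel_proj P.
Proof.
by move=> P0 B C g _ f; exists \0 => x; rewrite [x]P0 !linear0.
Qed.

Lemma cyc_bd_epi Y i : rel_exact Y -> rel_epi (cyc_bd Y i).
Proof.
move=> hY P hP f.
have [|h hh] := hY P hP i (cyc_in Y i \o f); first by move=> x; apply: cyc_inP.
by exists h => x; apply: cyc_in_inj; rewrite cyc_bdE hh.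
Qed.

(** A relative form of Schanuel's lemma: when the cycles [cycles Y i] are a
    retract of [A] up to a relative projective [Q], the next cycles are a
    retract of the first syzygy of [A] up to [Y (i + 1 + 1)].  After [n] steps the
    syzygy is relative projective, and so are its retracts. *)
Lemma rel_proj_cycles (Y : complex R) :
  rel_exact Y -> (forall i, rel_proj (Y i)) ->
  forall n i (A Q : lmodType R) (s1 : {linear cycles Y i -> A})
    (s2 : {linear cycles Y i -> Q}) (r1 : {linear A -> cycles Y i})
    (r2 : {linear Q -> cycles Y i}),
  (forall z, r1 (s1 z) + r2 (s2 z) = z) -> rel_proj Q -> rel_dim n A ->
  rel_proj (cycles Y (i + n%:Z)).
Proof.
move=> eY pY; elim=> [|n IH] i A Q s1 s2 r1 r2 rs pQ.
  rewrite addr0 => pA B C g eg f.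
  have [h1 hh1] := pA _ _ g eg (f \o r1).
  have [h2 hh2] := pQ _ _ g eg (f \o r2).
  exists ((h1 \o s1) \+ (h2 \o s2)) => z.
  by rewrite /= linearD hh1 hh2 /= -linearD rs.
case=> P [K [g [u [pP eg iu ku dK]]]].
have ek := cyc_bd_epi (Y := Y) (i := i) eY.
pose k := cyc_bd Y i; pose k2 := s2 \o k.
have [a1 ha1] := pY _ _ _ g eg (s1 \o k).
have [b1 hb1] := pP _ _ k ek (r1 \o g).
have [b2 hb2] := pQ _ _ k ek r2.
have [|t1 ht1] := factor_inj (f := a1 \o cyc_in Y (i + 1)) iu.
  move=> z; apply/ku; rewrite ha1 /=.
  suff -> : k (cyc_in Y (i + 1) z) = 0 by rewrite linear0.
  by apply/cyc_bd0/cyc_inP.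
have [|q1 hq1] := @cyc_factor _ Y (i + 1) _ (b1 \o u).
  move=> y; apply/cyc_bd0; rewrite -/k /= hb1 /=.
  suff -> : g (u y) = 0 by rewrite linear0.
  by apply/ku; exists y.
have [|q2 hq2] := @cyc_factor _ Y (i + 1) _ (idfun \- ((b1 \o a1) \+ (b2 \o k2))).
  move=> y; apply/cyc_bd0; rewrite -/k /= linearB linearD /= hb1 /= ha1 hb2 /=.
  by rewrite rs subrr.
(* the next cycles are a retract of [K] up to [Y (i + 1 + 1)] *)
have -> : i + n.+1%:Z = i + 1 + n%:Z by lia.
apply: (IH (i + 1) K (Y (i + 1 + 1)) t1 (cyc_in Y (i + 1)) q1 q2) => // z.
apply: cyc_in_inj; rewrite linearD hq1 hq2 /= ht1 /=.
suff kz : k (cyc_in Y (i + 1) z) = 0 by rewrite /k2 /= kz !linear0 addr0 subrKC.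
by apply/cyc_bd0/cyc_inP.
Qed.

(** Sections [tau i] of [Y (i + 1 + 1) -> cycles i] split the complex: [a] is the
    projection of each term onto the image of the section, along the cycles, and
    the contraction is [tau] composed with the complementary projection onto the cycles. *)
Lemma rel_contractible (Y : complex R) :
  rel_exact Y -> (forall i, rel_proj (cycles Y i)) -> null_homotopic (cm_id Y).
Proof.
move=> eY pZ.
have /dep_choice [tau htau] i : exists tau : {linear cycles Y i -> Y (i + 1 + 1)},
    forall z, cyc_bd Y i (tau z) = z.
  exact: (pZ i _ _ _ (cyc_bd_epi (i := i) eY) idfun).
have dtau i z : cx_d Y (i + 1) (tau i z) = cyc_in Y i z by rewrite -cyc_bdE htau.
(* [a] is defined in degrees [i + 1 + 1], hence in all degrees *)
have [a ha] : exists a : forall i, {linear Y i -> Y i},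
    forall i y, a (i + 1 + 1) y = tau i (cyc_bd Y i y).
  have [b hb] := pred_family (T := fun i => {linear Y (i + 1) -> Y (i + 1)})
    (fun i => tau i \o cyc_bd Y i).
  have [a ha] := pred_family (T := fun i => {linear Y i -> Y i}) b.
  by exists a => i y; rewrite ha hb.
have da : forall i y, cx_d Y i (a (i + 1) y) = cx_d Y i y.
  by apply: int_predE => i y; rewrite ha dtau cyc_bdE.
have ad : forall i y, a (i + 1) (cx_d Y (i + 1) y) = 0.
  apply: int_predE => i y; rewrite ha.
  suff -> : cyc_bd Y i (cx_d Y (i + 1 + 1) y) = 0 by rewrite linear0.
  by apply/cyc_bd0; rewrite cx_dd.
have /dep_choice [c hc] i : exists c : {linear Y (i + 1) -> cycles Y i},
    forall y, cyc_in Y i (c y) = y - a (i + 1) y.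
  by apply: (cyc_factor (f := idfun \- a (i + 1))) => y; rewrite /= linearB da subrr.
have [s hs] := pred_family (T := fun i => {linear Y i -> Y (i + 1)}) (fun i => tau i \o c i).
exists s; apply: int_predE => i x.
rewrite !hs /= dtau hc.
suff -> : c i (cx_d Y (i + 1) x) = cyc_bd Y i x by rewrite -ha subrK.
by apply: cyc_in_inj; rewrite hc ad subr0.
Qed.

(** The syzygies of a resolution are its modules of cycles.  The terms of [Y] vanish
    above degree [d + 1], so the syzygy numbered [d + 2], which lies in
    [Y (d + 2)], is zero. *)
Lemma resolution_rel_dim d (A : lmodType R) (Y : complex R) :
  rel_exact Y -> resolution N d A Y -> rel_dim d.+2 A.
Proof.
move=> eY [[phi [psi phiK psiK]] NY Y0].
have pY (j : int) : 0 < j -> rel_proj (Y j).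
  case: j => [[|m]|m] // _.
  have [md|dm] := leqP m d; first by apply: rel_projN; apply: NY.
  by apply: rel_proj0; apply: Y0; apply/orP; right; lia.
have dimZ n (i : int) : 0 <= i -> d.+1%:Z <= i + n%:Z -> rel_dim n (cycles Y i).
  elim: n i => [|n IH] i i0 hi /=.
    apply: rel_proj0 => z; apply: cyc_in_inj; rewrite linear0.
    by apply: Y0; apply/orP; right; lia.
  exists (Y (i + 1 + 1)), (cycles Y (i + 1)), (cyc_bd Y i), (cyc_in Y (i + 1)); split.
  - by apply: pY; lia.
  - exact: cyc_bd_epi.
  - exact: cyc_in_inj.
  - move=> x; rewrite cyc_bd0; split=> [hx|[y <-]]; last exact: cyc_inP.
    by exists (Sub x (introT (in_subP (ker (cx_d Y (i + 1))) x) hx)).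
  - by apply: IH; lia.
have psil : linear psi.
  by move=> a x y; apply: (can_inj phiK); rewrite linearP !psiK.
exists (Y (0 + 1)), (cycles Y 0), (phi \o cx_d Y 0), (cyc_in Y 0); split.
- exact: pY.
- move=> P hP f.
  (* degree [-1], where [Negz 0 + 1] computes to [0] *)
  have [|h hh] := eY P hP (Negz 0) (lin_of psil \o f).
    by move=> x; apply: Y0.
  by exists h => x; rewrite /= [X in phi X]hh /= /lin_of psiK.
- exact: cyc_in_inj.
- move=> x; split=> [hx|[y <-]]; last by rewrite /= cyc_inP linear0.
  have hx' : cx_d Y 0 x = 0 by apply: (can_inj phiK); rewrite linear0.
  by exists (Sub x (introT (in_subP (ker (cx_d Y 0)) x) hx')).
- by apply: dimZ; lia.
Qed.
End Relative.

(** * Flatness from purity *)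

Lemma rV_fp (R : pzRingType) n : finitely_presented 'rV[R]_n.
Proof.
exists 0%N, n, \0, idfun; split=> [x|x]; first by exists x.
by split=> [/= ->|[y <-] //]; exists 0.
Qed.

Lemma rV_fg (R : pzRingType) n : finitely_generated 'rV[R]_n.
Proof. by exists n, idfun => x; exists x. Qed.

(** Every finite set of relations satisfied by elements of [W] becomes trivial in
    a finite free module through which these elements factor: the equational
    criterion for flatness. *)
Definition kills_relations (R : pzRingType) (W : lmodType R) :=
  forall p (y : {linear 'rV[R]_p -> W}) n (r : {linear 'rV[R]_n -> 'rV[R]_p}),
    (forall c, y (r c) = 0) ->
    exists q (al : {linear 'rV[R]_p -> 'rV[R]_q}) (be : {linear 'rV[R]_q -> W}),
      (forall x, be (al x) = y x) /\ forall c, al (r c) = 0.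

Section Tensor.
Variables (R : pzRingType) (A : lmodType R^c) (F : lmodType R) (T : zmodType).
Variable t : A -> F -> T.

Definition tensor_sums : {pred T} := fun z => `[< exists (K : finType) (a : K -> A)
  (x : K -> F), z = \sum_k t (a k) (x k) >].

Hypothesis bt : balanced t.

Lemma balanced0r a : t a 0 = 0.
Proof. by case: bt => _ h _; apply: (addrI (t a 0)); rewrite -h !addr0. Qed.

Lemma balanced0l x : t 0 x = 0.
Proof. by case: bt => h _ _; apply: (addrI (t 0 x)); rewrite -h !addr0. Qed.

Lemma balancedNl a x : t (- a) x = - t a x.
Proof.
case: bt => h _ _; apply/eqP.
by rewrite -subr_eq0 opprK -h addNr balanced0l.
Qed.

Lemma balanced_suml (K : finType) (a : K -> A) x :
  t (\sum_k a k) x = \sum_k t (a k) x.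
Proof.
apply: (big_morph (fun a => t a x)) => [a1 a2|]; last exact: balanced0l.
by case: bt.
Qed.

Lemma balanced_sumr (K : finType) a (x : K -> F) :
  t a (\sum_k x k) = \sum_k t a (x k).
Proof.
apply: (big_morph (fun x => t a x)) => [x1 x2|]; last exact: balanced0r.
by case: bt.
Qed.

Lemma tensor_sums_zmod_closed : zmod_closed tensor_sums.
Proof.
split.
  apply/asboolP; exists 'I_0, (fun=> 0), (fun=> 0).
  by rewrite big_ord0.
move=> z1 z2 /asboolP[K1 [a1 [x1 ->]]] /asboolP[K2 [a2 [x2 ->]]]; apply/asboolP.
exists (K1 + K2)%type,
  (fun k => match k with inl k => a1 k | inr k => - a2 k end),
  (fun k => match k with inl k => x1 k | inr k => x2 k end).
rewrite big_sumType /=; congr (_ + _); rewrite -sumrN.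
by apply: eq_bigr => k _; rewrite balancedNl.
Qed.
End Tensor.

Record subgroup (T : zmodType) := Subgroup {
  sg_mem : {pred T};
  sg_closed : zmod_closed sg_mem }.
HB.instance Definition _ (T : zmodType) (S : subgroup T) :=
  GRing.isZmodClosed.Build T (sg_mem S) (sg_closed S).

Lemma quot_map (T : zmodType) (S : {pred T}) : zmod_closed S ->
  exists (G : zmodType) (q : {additive T -> G}), forall x, q x = 0 <-> x \in S.
Proof.
move=> Sc; pose Z := Subgroup Sc.
pose q : {additive T -> Quotient.quot (sg_mem Z)} := \pi_(Quotient.quot (sg_mem Z))%qT.
exists (Quotient.quot (sg_mem Z)), q => x.
rewrite -(raddf0 q) -[X in _ <-> X \in _]subr0.
by split=> [/eqP|xS]; last apply/eqP; rewrite /q /= -Quotient.idealrBE.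
Qed.

Section TensorGen.
Variables (R : pzRingType) (A : lmodType R^c) (F : lmodType R) (T : zmodType).
Variable t : A -> F -> T.

(** Both the projection to the quotient by the sums of tensors and zero
    extend the zero balanced map. *)
Lemma tensor_gen (z : T) : is_tensor t -> exists (K : finType) (a : K -> A) (x : K -> F),
  z = \sum_k t (a k) (x k).
Proof.
move=> [bt ut]; apply/asboolP.
have [G [q hq]] := quot_map (tensor_sums_zmod_closed bt).
have bz : balanced (fun (_ : A) (_ : F) => 0 : G) by split=> *; rewrite ?addr0.
have [h [hh uh]] := ut G _ bz.
have e1 : h = q.
  apply: uh => a x; apply/hq/asboolP; exists 'I_1, (fun=> a), (fun=> x).
  by rewrite big_ord1.
have e2 : h = \0 by apply: uh.
by apply/hq; rewrite -e1 e2.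
Qed.
End TensorGen.

Section TensorZero.
Variables (R : pzRingType) (B : lmodType R^c) (W : lmodType R).

Let D : lmodType R^c := dsum (fun _ : W => B).
Let delta (x : W) : {linear B -> D} := dsum_incl (fun _ : W => B) x.

Lemma deltaE x b w : delta x b w = if w == x then b else 0.
Proof.
rewrite /delta /=; have [->|wx] := eqVneq w x; first by rewrite dfwith_in.
by rewrite dfwith_out // eq_sym.
Qed.

(** The kernel of the canonical map from the direct sum of copies of [B]
    indexed by [W] onto the tensor product. *)
Definition tensor_ker : {pred D} := fun f => `[< exists (P J : finType) (s : P -> W)
  (b : J -> B) (kap : J -> P -> R), (forall j, \sum_i kap j i *: s i = 0) /\
  f = \sum_i delta (s i) (\sum_j (kap j i : R^c) *: b j) >].

Lemma tensor_ker_zmod_closed : zmod_closed tensor_ker.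
Proof.
split.
  apply/asboolP; exists 'I_0, 'I_0, (fun=> 0), (fun=> 0), (fun _ _ => 0).
  by split=> [[]//|]; rewrite big_ord0.
move=> f1 f2 /asboolP[P1 [J1 [s1 [b1 [k1 [h1 ->]]]]]] /asboolP[P2 [J2 [s2 [b2 [k2 [h2 ->]]]]]].
apply/asboolP; exists (P1 + P2)%type, (J1 + J2)%type,
  (fun i => match i with inl i => s1 i | inr i => s2 i end),
  (fun j => match j with inl j => b1 j | inr j => - b2 j end),
  (fun j i => match j, i with
     inl j, inl i => k1 j i | inr j, inr i => k2 j i | _, _ => 0 end).
split=> [[j|j]|]; rewrite big_sumType /=.
- by rewrite h1 add0r big1 // => i _; rewrite scale0r.
- by rewrite h2 addr0 big1 // => i _; rewrite scale0r.
congr (_ + _); rewrite -?sumrN; apply: eq_bigr => i _; rewrite big_sumType /=.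
  by rewrite [X in _ + X]big1 ?addr0 // => j _; apply: scale0r.
rewrite [X in X + _]big1 ?add0r => [|j _]; last exact: scale0r.
by rewrite -linearN -sumrN; congr (delta _ _); apply: eq_bigr => j _; rewrite scalerN.
Qed.

Lemma sum_seq_nth (V : zmodType) (U : seq W) (F : W -> V) :
  \sum_(i < size U) F (nth 0 U i) = \sum_(w <- U) F w.
Proof. by rewrite (big_nth 0) big_mkord. Qed.

Lemma sum_eq_scale (U : seq W) x (c : R) : uniq U -> x \in U ->
  \sum_(w <- U) (if w == x then c else 0) *: w = c *: x.
Proof.
move=> uU xU; rewrite (bigD1_seq x) //= eqxx big1 ?addr0 // => w /negPf ->.
by rewrite scale0r.
Qed.

(** A vanishing sum of tensors vanishes for a reason expressible by finitely many
    elements: a finite free module with a map [y] to [W], lifts [l k] of the [x k], and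
    relations [kap], such that the sum of the [b k] against the [l k] equals a sum of
    elements [b' j] against the relations.  The universal property is used for the
    balanced map to the concrete tensor product, the quotient by [tensor_ker]. *)
Lemma tensor_zero (T : zmodType) (t : B -> W -> T) (K : finType) (b : K -> B) (x : K -> W) :
  is_tensor t -> \sum_k t (b k) (x k) = 0 ->
  exists p (y : {linear 'rV[R]_p -> W}) (l : K -> 'rV[R]_p) (J : finType)
    (kap : J -> 'rV[R]_p) (b' : J -> B),
    [/\ forall k, y (l k) = x k, forall j, y (kap j) = 0 &
        forall i, \sum_k (l k 0 i : R^c) *: b k = \sum_j (kap j 0 i : R^c) *: b' j].
Proof.
move=> [bt ut] tz.
have [G [q hq]] := quot_map tensor_ker_zmod_closed.
have bg : balanced (fun b x => q (delta x b)).
  split=> [b1 b2 w|c w1 w2|r c w].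
  - by rewrite linearD raddfD.
  - apply/eqP; rewrite -subr_eq0 -!raddfD -raddfB; apply/eqP/hq/asboolP.
    exists 'I_3, 'I_1, (fun i : 'I_3 => nth 0 [:: w1 + w2; w1; w2] i), (fun=> c),
      (fun _ (i : 'I_3) => nth 0 [:: 1; -1; -1] i).
    split=> [_|].
      rewrite !big_ord_recl big_ord0 /= scale1r !scaleN1r addr0.
      by rewrite -opprD subrr.
    rewrite !big_ord_recl !big_ord0 /= !addr0 scale1r !scaleN1r !linearN.
    by rewrite opprD.
  - apply/eqP; rewrite -subr_eq0 -raddfB; apply/eqP/hq/asboolP.
    exists 'I_2, 'I_1, (fun i : 'I_2 => nth 0 [:: w; r *: w] i), (fun=> c),
      (fun _ (i : 'I_2) => nth 0 [:: r; -1] i).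
    split=> [_|].
      by rewrite !big_ord_recl big_ord0 /= scaleN1r addr0 subrr.
    by rewrite !big_ord_recl !big_ord0 /= !addr0 !scaleN1r !linearN.
have [h [hh _]] := ut G _ bg.
have : q (\sum_k delta (x k) (b k)) = 0.
  transitivity (h (\sum_k t (b k) (x k))); last by rewrite tz raddf0.
  by rewrite !raddf_sum; apply: eq_bigr => k _; rewrite hh.
move/hq/asboolP => [P [J [s [b' [kap [sk e]]]]]].
(* the free module on the finitely many elements of [W] involved *)
pose U := undup (codom x ++ codom s).
have uU : uniq U := undup_uniq _.
have xU k : x k \in U by rewrite mem_undup mem_cat codom_f.
have sU i : s i \in U by rewrite mem_undup mem_cat codom_f orbT.
pose u i := nth 0 U i.
exists (size U), (lincomb (fun i : 'I_(size U) => u i)),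
  (fun k => \row_i (if u i == x k then 1 else 0)), J,
  (fun j => \row_i \sum_v (if u i == s v then kap j v else 0)), b'.
split=> [k|j|i].
- rewrite /= /lincomb; under eq_bigr => i _ do rewrite mxE.
  rewrite (sum_seq_nth U (fun w => (if w == x k then 1 else 0) *: w)).
  by rewrite sum_eq_scale // scale1r.
- rewrite /= /lincomb; under eq_bigr => i _ do rewrite mxE.
  rewrite (sum_seq_nth U (fun w => (\sum_v (if w == s v then kap j v else 0)) *: w)).
  under eq_bigr => w _ do rewrite scaler_suml.
  rewrite exchange_big /= -[RHS](sk j); apply: eq_bigr => v _.
  by rewrite sum_eq_scale.
have := congr1 (fun f : D => f (u i)) e.
rewrite /= !dsum_sum => ei.
transitivity (\sum_k delta (x k) (b k) (u i)).
  apply: eq_bigr => k _; rewrite deltaE mxE; case: eqP => _; first by rewrite scale1r.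
  by rewrite scale0r.
rewrite [LHS]ei.
transitivity (\sum_v \sum_j ((if u i == s v then kap j v else 0 : R) : R^c) *: b' j).
  apply: eq_bigr => v _; rewrite deltaE; case: eqP => // _.
  by rewrite big1 // => j _; rewrite scale0r.
rewrite exchange_big /=; apply: eq_bigr => j _.
by rewrite mxE scaler_suml.
Qed.
End TensorZero.

(** Trivialise by [al] the relations given by [tensor_zero].  In the resulting free module
    the vanishing of the sum can be read off coordinatewise in [B], and descends to [A]
    because [u] is injective. *)
Lemma kills_relations_flat (R : pzRingType) (W : lmodType R) : kills_relations W -> flat W.
Proof.
move=> crit A B u iu TA TB tA tB hA hB h hh; apply: raddf_inj => z hz.
have [K [a [x zE]]] := tensor_gen z hA.
have [|p [y [l [J [kap [b' [yl yk e]]]]]]] := @tensor_zero _ _ _ _ _ K (fun k => u (a k)) x hB.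
  by rewrite -[RHS]hz zE [RHS]raddf_sum; apply: eq_bigr => k _; rewrite hh.
have [|q [al [be [hbe hal]]]] := crit p y #|J| (lincomb (fun j => kap (enum_val j))).
  move=> c; rewrite /= /lincomb linear_sum big1 // => j _.
  by rewrite linearZ /= yk scaler0.
have alk j : al (kap j) = 0.
  by have := hal (delta_mx 0 (enum_rank j)); rewrite /= lincomb_delta enum_rankK.
have [bA _] := hA.
(* after [al], the relations have become trivial, coordinate by coordinate *)
have coord i : \sum_k (al (l k) 0 i : R^c) *: a k = 0.
  apply: iu; rewrite linear0 linear_sum.
  have expand m (v : 'rV[R]_p) (c : B) : (al v 0 m : R^c) *: c =
      \sum_s (al (delta_mx 0 s) 0 m : R^c) *: ((v 0 s : R^c) *: c).
    rewrite {1}[v]row_sum_delta linear_sum summxE scaler_suml.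
    by apply: eq_bigr => s _; rewrite linearZ mxE scalerA.
  under eq_bigr => k _ do rewrite linearZ /= expand.
  rewrite exchange_big /=.
  under eq_bigr => s _ do rewrite -scaler_sumr e scaler_sumr.
  rewrite exchange_big /= big1 // => j _.
  by rewrite -expand alk mxE scale0r.
rewrite zE.
transitivity (\sum_i tA (\sum_k (al (l k) 0 i : R^c) *: a k) (be (delta_mx 0 i))); last first.
  by rewrite big1 // => i _; rewrite coord (balanced0l bA).
under [RHS]eq_bigr => i _ do rewrite (balanced_suml bA).
rewrite exchange_big /=; apply: eq_bigr => k _.
rewrite -yl -hbe (lincombE be) /lincomb (balanced_sumr bA).
by apply: eq_bigr => i _; case: bA => _ _ ->.
Qed.

(** * The two finiteness conditions *)

Section Projective.
Variable R : pzRingType.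

Lemma projective_dsum (I : choiceType) (A : I -> lmodType R) :
  (forall i, projective (A i)) -> projective (dsum A).
Proof.
move=> pA B C g f sg.
have /dep_choice [h hh] i : exists h : {linear A i -> B}, forall x, g (h x) = f (dsum_single x).
  exact: (pA i B C g (f \o dsum_incl A i) sg).
exists (dsum_copair h).
by apply: (@dsum_lin_ext _ _ _ _ (g \o dsum_copair h) f) => i a; rewrite /= dsum_copair_in hh.
Qed.

Lemma projective_Add (M : lmodType R) : projective M -> forall P, Add M P -> projective P.
Proof.
move=> pM P hP B C g f sg.
apply: (@Add_lift _ M B C C g \0 _ P hP f) => // k _.
exact: (pM _ _ g k sg).
Qed.

Lemma pure_projective_Add (M : lmodType R) :
  finitely_presented M -> forall P, Add M P -> pure_projective P.
Proof.
move=> fpM P hP Y pY i f; apply: (Add_lift _ hP) => k.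
exact: (pY M fpM i k).
Qed.

Lemma scale_by_linear (Q : lmodType R) (x : Q) : linear (fun r : R^o => (r : R) *: x).
Proof. by move=> a r s; rewrite scalerDl scalerA. Qed.
Definition scale_by (Q : lmodType R) (x : Q) : {linear R^o -> Q} :=
  lin_of (scale_by_linear x).

(** The canonical free module on the elements of [Q]. *)
Definition from_free (Q : lmodType R) : {linear dsum (fun _ : Q => R^o) -> Q} :=
  @dsum_copair R Q (fun=> R^o) Q (@scale_by Q).

(** Split the cover of [Q] by the free module on its elements. *)
Lemma from_free_split (Q : lmodType R) : projective Q ->
  exists s : {linear Q -> dsum (fun _ : Q => R^o)}, forall x, from_free Q (s x) = x.
Proof.
move=> pQ; apply: (pQ _ _ (from_free Q) idfun) => x.
exists (dsum_incl (fun _ : Q => R^o) x (1 : R)).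
by rewrite /= dsum_copair_in /= /lin_of scale1r.
Qed.

Lemma fg_projective_factor (N Q : lmodType R) (f : {linear N -> Q}) :
  finitely_generated N -> projective Q ->
  exists q (al : {linear N -> 'rV[R]_q}) (be : {linear 'rV[R]_q -> Q}),
    forall x, be (al x) = f x.
Proof.
move=> fgN /from_free_split [s hs].
have [U [uU hU]] := fg_dsum_supp (s \o f) fgN.
have all_ : linear (fun x => \row_(i < size U) s (f x) (nth 0 U i) : 'rV[R]_(size U)).
  by move=> a x y; apply/rowP => i; rewrite !mxE !linearP.
exists (size U), (lin_of all_), (lincomb (fun i => nth 0 U i)) => x.
rewrite -[RHS]hs /= (dsum_copairE _ uU (hU x)) /lin_of /lincomb.
under eq_bigr => i _ do rewrite mxE.
by rewrite (sum_seq_nth U (fun w => (s (f x) w : R) *: w)).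
Qed.

Lemma Add_regular : Add (R^o : lmodType R) = @projective R.
Proof.
apply/funext => P; apply/propext; split.
  apply: projective_Add => B C g f sg.
  have [b hb] := sg (f 1).
  exists (scale_by b) => r.
  by rewrite /= /lin_of linearZ /= hb -linearZ /= [r *: _]mulr1.
by move=> /from_free_split [s hs]; apply: retract_Add hs.
Qed.

(** Test on the free module of rank one. *)
Lemma pure_exact_exact (Y : complex R) : pure_exact Y -> exact Y.
Proof.
move=> pY i x dx.
have [|g hg] := pY _ (rV_fp R 1) i (lincomb (fun=> x)).
  by move=> c; rewrite /= /lincomb big_ord1 linearZ /= dx scaler0.
by exists (g (delta_mx 0 0)); rewrite hg /= lincomb_delta.
Qed.

(** The boundary map onto the cycles is surjective. *)
Lemma exact_rel_exact (Y : complex R) : exact Y -> rel_exact (@projective R) Y.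
Proof.
move=> eY P pP i f df.
have [h hh] := cyc_factor df.
have sb : surjective (cyc_bd Y i).
  move=> z; have [y hy] := eY i (cyc_in Y i z) (cyc_inP z).
  by exists y; apply: cyc_in_inj; rewrite cyc_bdE.
have [k hk] := pP _ _ (cyc_bd Y i) h sb.
by exists k => x; rewrite -cyc_bdE hk hh.
Qed.

(** By purity, a map from a finitely presented module [N] to the cycles lifts to
    the projective terms [Y (i + 1 + 1)]; finite generation of [N] makes this work for the
    direct sum, and then the lift factors through a finite free module.  For the
    criterion, [N] is the quotient of a free module by the given relations. *)
Lemma cycles_flat (Y : complex R) : pure_exact Y -> (forall i, projective (Y i)) ->
  flat (dsum (cycles Y)).
Proof.
move=> pY prY; apply: kills_relations_flat => p y n r yr.
pose N := quot_module (im r).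
have fpN : finitely_presented N.
  apply: (coker_fp (e := r) (q := @quot_proj _ _ (im r))); first exact: rV_fg.
  - exact: rV_fp.
  - exact: quot_proj_surj.
  - by move=> x; rewrite quot_proj_eq0.
have [|yb hyb] := factor_surj (f := y) (@quot_proj_surj _ _ (im r)).
  by move=> x /quot_proj_eq0 [c <-].
have [U [_ hU]] := fg_dsum_supp yb (fp_fg fpN).
have /dep_choice [L hL] i : exists L : {linear N -> Y (i + 1 + 1)},
    (i \notin U -> forall x, L x = 0) /\ forall x, cyc_bd Y i (L x) = yb x i.
  have [iU|iU] := boolP (i \in U).
    have [|L hL] := pY N fpN i (cyc_in Y i \o (dsum_proj i \o yb)).
      by move=> x; apply: cyc_inP.
    by exists L; split=> // x; apply: cyc_in_inj; rewrite cyc_bdE hL.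
  exists \0; split=> // x; rewrite linear0; apply/esym/eqP.
  by apply: contraNT iU; apply: hU.
have [|Lb hLb] := dsum_pair (A := fun i => Y (i + 1 + 1)) (f := L).
  move=> x; apply: (sub_finite_set _ (finite_seq U)) => i /=.
  by apply: contraR => iU; rewrite (hL i).1.
have [|q [al [be hab]]] := fg_projective_factor Lb (fp_fg fpN).
  by apply: projective_dsum => i; apply: prY.
exists q, (al \o @quot_proj _ _ (im r)), (dsum_map (cyc_bd Y) \o be); split=> [x|c] /=.
  rewrite hab -hyb; apply: dsum_ext => i /=.
  by rewrite hLb (hL i).2.
suff -> : @quot_proj _ _ (im r) (r c) = 0 by rewrite linear0.
by apply/quot_proj_eq0; exists c.
Qed.
End Projective.

(** The terms are pure projective, and each module of cycles has a pure
    resolution of length [d] itself: it serves as its own retract. *)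
Lemma pure_contractible (R : pzRingType) (M : lmodType R) :
  finitely_presented M -> finite_pure_global_dimension R ->
  forall Y : complex R, (forall i, Add M (Y i)) -> pure_exact Y ->
    null_homotopic (cm_id Y).
Proof.
move=> fpM [d hd] Y hY pY.
have rY (Z : complex R) : pure_exact Z -> rel_exact (@pure_projective R) Z.
  by move=> pZ P; apply.
apply: (rel_contractible (rY _ pY)) => i.
have -> : i = i - d.+2%:Z + d.+2%:Z by rewrite subrK.
pose C := cycles Y (i - d.+2%:Z).
have [X [pX rX]] := hd C.
have pp j : rel_proj (@pure_projective R) (Y j).
  exact/rel_projN/(pure_projective_Add fpM).
apply: (rel_proj_cycles (rY _ pY) pp (A := C) (Q := Y 0) (s1 := idfun) (s2 := \0)
  (r1 := idfun) (r2 := \0)) => //; first by move=> z; rewrite /= addr0.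
exact: (resolution_rel_dim (rY _ pX)).
Qed.

(** The modules of cycles could have different projective dimensions; they are all
    retracts of their direct sum, which is flat and so has one. *)
Lemma projective_contractible (R : pzRingType) (M : lmodType R) :
  projective M -> (forall F : lmodType R, flat F -> finite_projective_dimension F) ->
  forall Y : complex R, (forall i, Add M (Y i)) -> pure_exact Y ->
    null_homotopic (cm_id Y).
Proof.
move=> pM hfl Y hY pY.
have prY i : projective (Y i) by apply: projective_Add (hY i).
have rY := exact_rel_exact (pure_exact_exact pY).
have [d [X [eX rX]]] := hfl _ (cycles_flat pY prY).
apply: (rel_contractible rY) => i.
have -> : i = i - d.+2%:Z + d.+2%:Z by rewrite subrK.
set j := i - _.
have pp k : rel_proj (@projective R) (Y k) by apply/rel_projN/prY.
apply: (rel_proj_cycles rY pp (A := dsum (cycles Y)) (Q := Y 0)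
  (s1 := dsum_incl (cycles Y) j) (s2 := \0) (r1 := dsum_proj j) (r2 := \0)) => //.
  by move=> z; rewrite /= addr0; apply: dsum_single_in.
exact: (resolution_rel_dim (exact_rel_exact eX)).
Qed.

Section Regular.
Variable R : pzRingType.

Lemma regular_actA (x : R^o) a b : x * a * b = x * (a * b).
Proof. by rewrite mulrA. Qed.

Definition regular_bimodule : bimodule R :=
  @Bimodule R (R^o : lmodType R) (fun x a => x * a) regular_actA (@mulr1 R)
    (fun x y a => mulrDl x y a) (fun x a b => mulrDr x a b) (fun a x b => esym (mulrA a x b)).

(** The module is free on [a]; this covers the ring as a left and as a right module. *)
Lemma cyclic_free_fp (S : pzRingType) (A : lmodType S) (a : A) :
  (forall x, exists r, r *: a = x) -> (forall r, r *: a = 0 -> r = 0) ->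
  finitely_presented A.
Proof.
move=> ga fa; exists 0%N, 1%N, \0, (lincomb (fun=> a)); split=> [x|x].
  by have [r <-] := ga x; exists (const_mx r); rewrite /= /lincomb big_ord1 mxE.
split=> [|[y <-]]; last by rewrite linear0.
rewrite /= /lincomb big_ord1 => /fa x0; exists 0.
by apply/rowP => i; rewrite /= mxE ord1 x0.
Qed.

Lemma regular_left_fp : finitely_presented (bim_left regular_bimodule).
Proof.
apply: (@cyclic_free_fp R R^o 1) => [x|r]; first by exists x; apply: mulr1.
by rewrite [r *: _]mulr1.
Qed.

Lemma regular_right_fp : finitely_presented (bim_right regular_bimodule).
Proof.
apply: (@cyclic_free_fp R^c (bim_right regular_bimodule) (1 : R)) => [x|r].
  by exists x; apply: mul1r.
by rewrite [r *: _]mul1r.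
Qed.
End Regular.

Theorem mainTheorem2 (R : pzRingType) (R_coherent : right_coherent R) :
  (forall M : bimodule R,
     finitely_presented (bim_left M) -> finitely_presented (bim_right M) ->
       (finite_pure_global_dimension R ->
          compactly_generated (K (Add (bim_left M))))
       /\
       (projective (bim_left M) ->
        (forall F : lmodType R, flat F -> finite_projective_dimension F) ->
          compactly_generated (K (Add (bim_left M)))))
  /\
  ((forall F : lmodType R, flat F -> finite_projective_dimension F) ->
     compactly_generated (K (@projective R))).
Proof.
have main (M : bimodule R) : finitely_presented (bim_left M) ->
    finitely_presented (bim_right M) -> projective (bim_left M) ->
    (forall F : lmodType R, flat F -> finite_projective_dimension F) ->
    compactly_generated (K (Add (bim_left M))).
  move=> fpl fpr pM hfl; apply: K_Add_compactly_generated => //.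
  exact: projective_contractible.
split=> [M fpl fpr|hfl].
  split=> [hd|]; last exact: main.
  by apply: K_Add_compactly_generated => //; apply: pure_contractible.
rewrite -Add_regular; apply: (main (regular_bimodule R)) => //.
- exact: regular_left_fp.
- exact: regular_right_fp.
rewrite -Add_regular; apply: (@retract_Add _ _ _ unit (dsum_incl (fun=> R^o) tt)
  (dsum_proj tt)) => x.
exact: dsum_single_in.
Qed.
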